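(* If $Q\in\mu^D$, that is, if $Q$ is a quiver that is mutation equivalent to an orientation of a type D Dynkin diagram, then $Q$ is a $\mathcal{Q}^N$ quiver (for some $N\ge1$).
   Context: Quivers are finite connected directed graphs without loops or 2-cycles. The mutation $\mu_k$ of a quiver at a vertex $k$ does: (1) for every two-arrow path $i\to k\to j$ add a new arrow $i\to j$; (2) reverse all arrows incident to $k$; (3) repeatedly remove oriented 2-cycles until none remain. Two quivers are mutation equivalent if a finite sequence of mutations sends one to the other. $\mu^D$ denotes the set of quivers mutation equivalent to orientations of type D Dynkin diagrams. $\mathcal{Q}^N$ quivers. For $N\ge1$, a quiver $Q^N$ is a finite connected quiver with vertex set $\{v^i_\ell\mid 1\le i\le N,\ 1\le \ell\le k_i\}$ (with $k_i\ge1$) whose arrows are exactly: (1) the vertical arrows $v^i_1\leftarrow v^i_2\leftarrow\cdots\leftarrow v^i_{k_i}$ for $i=1,\dots,N$ (the $i$-th vertical chain); (2) oblique arrows: for two distinct chains, the arrows between them (if there are any) form exactly one path $v^i_{a_1}\to v^j_{b_1}\to v^i_{a_2}\to v^j_{b_2}\to v^i_{a_3}\to\cdots$ (starting in one of the two chains, called chain $i$, and ending in either), with $1\le a_1<a_2<\cdots\le k_i$ and $1\le b_1<b_2<\cdots\le k_j$; (3) if $3\le m\le N$, $i_1,\dots,i_m$ are pairwise distinct and there is an arrow (in either direction) between the chains $i_r$ and $i_{r+1}$ for each $r=1,\dots,m-1$, then there is no arrow between the chains $i_1$ and $i_m$. A quiver is called a $\mathcal{Q}^N$ quiver if its vertices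 can be labelled so that it has this form for some $N\ge 1$. *)

(* Defs.v *)
From mathcomp Require Import all_boot.
Set Implicit Arguments.
Unset Strict Implicit.
Unset Printing Implicit Defensive.

(* A directed multigraph on V is given by its arrow multiplicities:
   A x y is the number of arrows from x to y. *)
Definition adj (V : finType) (A : V -> V -> nat) : rel V :=
  fun x y => (0 < A x y) || (0 < A y x).

Record quiver (V : finType) := Quiver {
  arrows :> V -> V -> nat;
  quiver_noloop : forall x, arrows x x = 0;
  quiver_no2cycle : forall x y, 0 < arrows x y -> arrows y x = 0;
  quiver_connected : forall x y, connect (adj arrows) x y }.

Section Mutation.
Variables (V : finType) (k : V).
Implicit Type A : V -> V -> nat.

Definition add_composites A x y := A x y + A x k * A k y.

Definition reverse_at A x y := if (x == k) || (y == k) then A y x else A x y.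

(* Removing 2-cycles one at a time until none remain deletes
   minn (A x y) (A y x) of them; the subtraction is truncated. *)
Definition cancel_2cycles A x y := A x y - A y x.

Definition mutate_arrows A := cancel_2cycles (reverse_at (add_composites A)).

Variable Q : quiver V.

Fact mutate_noloop x : mutate_arrows Q x x = 0.
Proof. exact: subnn. Qed.

Fact mutate_no2cycle x y :
  0 < mutate_arrows Q x y -> mutate_arrows Q y x = 0.
Proof.
by rewrite /mutate_arrows /cancel_2cycles subn_gt0 => /ltnW; rewrite -subn_eq0 => /eqP.
Qed.

Fact mutate_arrows_l x : mutate_arrows Q k x = Q x k.
Proof.
rewrite /mutate_arrows /cancel_2cycles /reverse_at /add_composites eqxx orbT /=.
rewrite !(quiver_noloop Q k) muln0 mul0n !addn0.
case: (posnP (Q x k)) => [->|]; first by rewrite sub0n.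
by move/(quiver_no2cycle (q := Q)) ->; rewrite subn0.
Qed.

Fact mutate_arrows_r x : mutate_arrows Q x k = Q k x.
Proof.
rewrite /mutate_arrows /cancel_2cycles /reverse_at /add_composites eqxx orbT /=.
rewrite !(quiver_noloop Q k) muln0 mul0n !addn0.
case: (posnP (Q k x)) => [->|]; first by rewrite sub0n.
by move/(quiver_no2cycle (q := Q)) ->; rewrite subn0.
Qed.

Fact mutate_connected x y : connect (adj (mutate_arrows Q)) x y.
Proof.
have adjC : symmetric (adj (mutate_arrows Q)) by move=> u v; rewrite /adj orbC.
have adjk u : adj (mutate_arrows Q) u k = adj Q u k.
  by rewrite /adj mutate_arrows_l mutate_arrows_r orbC.
suff step u v : 0 < Q u v -> connect (adj (mutate_arrows Q)) u v.
  apply: (connect_sub _ (quiver_connected Q x y)) => u v /orP[/step //|/step].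
  by rewrite (sym_connect_sym adjC).
move=> uv; have vu := quiver_no2cycle uv.
have [vk|vk] := eqVneq v k.
  by apply: connect1; rewrite vk adjk /adj -vk uv.
have [uk|uk] := eqVneq u k.
  by apply: connect1; rewrite uk adjC adjk /adj -uk uv orbT.
have [/andP[vQ uQ]|h] := boolP ((0 < Q v k) && (0 < Q k u)).
  apply: (@connect_trans _ _ k); apply: connect1; last rewrite adjC;
  by rewrite adjk /adj ?vQ ?uQ ?orbT.
apply: connect1; rewrite /adj /mutate_arrows /cancel_2cycles /reverse_at.
rewrite (negPf uk) (negPf vk) /= /add_composites vu.
have -> : Q v k * Q k u = 0.
  by apply/eqP; rewrite -leqn0 leqNgt muln_gt0.
by rewrite subn0 addn_gt0 uv.
Qed.

Definition mutate : quiver V :=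
  Quiver mutate_noloop mutate_no2cycle mutate_connected.

End Mutation.

Definition quiver_iso (V W : finType) (Q : quiver V) (Q' : quiver W) : Prop :=
  exists2 f : V -> W, bijective f & forall x y, Q' (f x) (f y) = Q x y.

(* Quivers are considered up to isomorphism. *)
Definition mutation_equivalent (V W : finType) (Q : quiver V) (Q' : quiver W) :
  Prop := exists s : seq V, quiver_iso (foldl (fun R k => mutate k R) Q s) Q'.

Definition is_orientation (V : finType) (e : rel V) (Q : quiver V) : Prop :=
  forall x y, Q x y + Q y x = e x y.

(* Vertices 0 - 1 - ... - (n-2) form a path, and n-1 is joined to n-3. *)
Definition dynkinD_half (n : nat) : rel nat := fun i j =>
  ((j == i.+1) && (j.+1 < n)) || ((i.+3 == n) && (j.+1 == n)).

Definition dynkinD (n : nat) : rel 'I_n :=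
  fun i j => dynkinD_half n i j || dynkinD_half n j i.

Definition muD (V : finType) (Q : quiver V) : Prop :=
  exists (n : nat) (D : quiver 'I_n),
    [/\ 4 <= n, is_orientation (@dynkinD n) D & mutation_equivalent D Q].

Section QN.
Variables (N : nat) (k : 'I_N -> nat).

(* vtx i l is the vertex v^{i+1}_{l+1}: chains and positions are numbered
   from 0. *)
Definition vtx (i : 'I_N) (l : 'I_(k i)) : {i : 'I_N & 'I_(k i)} :=
  Tagged (fun i => 'I_(k i)) l.

Variable Q : quiver {i : 'I_N & 'I_(k i)}.

Definition vertical_chains : Prop :=
  forall (i : 'I_N) (l m : 'I_(k i)), Q (vtx l) (vtx m) = (l == m.+1 :> nat).

Definition linked : rel 'I_N := fun i j =>
  [exists l : 'I_(k i), exists m : 'I_(k j), adj Q (vtx l) (vtx m)].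

(* The arrows between the chains i and j are those of the path
   a_1 -> b_1 -> a_2 -> b_2 -> ..., with the a's in chain i and the b's in
   chain j; the size condition lets the path end in either chain. *)
Definition oblique_path (i j : 'I_N) : Prop :=
  exists (a : seq 'I_(k i)) (b : seq 'I_(k j)),
    [/\ sorted ltn (map val a), sorted ltn (map val b),
        size b <= size a <= (size b).+1,
        forall l m, Q (vtx l) (vtx m) = ((l, m) \in zip a b)
      & forall l m, Q (vtx m) (vtx l) = ((m, l) \in zip b (behead a))].

Definition oblique_arrows : Prop :=
  forall i j, i != j -> linked i j -> oblique_path i j \/ oblique_path j i.

Definition no_chain_cycle : Prop :=
  forall (i : 'I_N) (s : seq 'I_N),
    3 <= size (i :: s) <= N -> uniq (i :: s) -> path linked i s ->
    ~~ linked i (last i s).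

Definition QN_form : Prop :=
  [/\ 1 <= N, forall i, 1 <= k i, vertical_chains, oblique_arrows
    & no_chain_cycle].

End QN.

Definition QN_quiver (V : finType) (Q : quiver V) : Prop :=
  exists (N : nat) (k : 'I_N -> nat) (R : quiver {i : 'I_N & 'I_(k i)}),
    QN_form R /\ quiver_iso R Q.

(* Main.v *)
Require Import Defs.
From mathcomp Require Import all_boot ssralg ssrnum ssrint.
From mathcomp Require Import zify ring.

Set Implicit Arguments.
Unset Strict Implicit.
Unset Printing Implicit Defensive.

Import GRing.Theory.
Local Open Scope ring_scope.

(** A quiver mutation equivalent to D_n comes from a triangulation of a disc
    with n marked boundary points and one puncture: vertices are arcs, each
    triangle contributes an oriented 3-cycle on those of its sides that are
    arcs, opposite arrows cancel, and mutation at a vertex is the flip of the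
    corresponding arc.  The proof encodes these triangulations as finite trees,
    shows directly that mutation preserves the encoding, and then reads the
    chains off a triangulation.

    Near the puncture a triangulation has one of two shapes.  In a [Wheel],
    arcs p_1, ..., p_m (m >= 2) join the puncture to the boundary in cyclic
    order, and beyond the triangle on p_i and p_(i+1) lies a triangulated
    polygon T_i.  In a [Fork], two parallel arcs p and q (the plain and the
    tagged version of one arc) sit in a digon with polygons T and U beyond its
    two sides.  A triangulated polygon with a marked side is a binary [tree],
    and the flip of an arc inside it is a tree rotation.  Quivers are handled
    through their skew-symmetric integer forms, in which the contributions of
    the triangles add up; a flip then touches two triangles and the rest of
    the form is a constant summand ([mutates_frame], [mutates_flip]).  The
    outcome is [triangulation_mutates], and [dynkin_spanning] starts the
    induction by realizing every orientation of the diagram.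

    For the chains, a triangulation is built by successive enlargements
    ([grows_cons]), each adding a chain that is joined to a single older chain
    by a single zigzag of oblique arrows.  Hence the graph of chains is a tree,
    which gives the absence of cycles of chains.  In a polygon, the children l
    and r of an arc v form the new chain l -> r, joined to the chain of v by
    r -> v -> l ([grows_tree]).  In a wheel with m >= 3 the arcs
    p_1, ..., p_(m-1) form one chain; p_m together with the arcs closing the
    two triangles at p_m forms a second one, and the arrows between these two
    are the one genuinely long zigzag ([wheel_laid_out]). *)

(** * Skew forms and mutation *)

Section Forms.
Variable V : finType.
Implicit Types (a b c d o : option V) (k u v x y : V) (B D R : V -> V -> int).

(** Absent sides of a triangle (boundary edges) are [None] and have the zero
    indicator, so triangles with fewer than three arcs need no special case. *)
Definition ind o x : int := if o is Some a then ((x == a) : nat)%:Z else 0.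

Definition wedge a b x y : int := ind a x * ind b y - ind b x * ind a y.

(** The 3-cycle a -> b -> c -> a. *)
Definition tri a b c x y : int := wedge a b x y + wedge b c x y + wedge c a x y.

Definition realizes (Q : quiver V) B : Prop :=
  forall x y, (Q x y)%:Z - (Q y x)%:Z = B x y.

(** Mutation at [k] for forms, with the multiplicities [i] of arrows into [k]
    and [o] out of [k] given explicitly: the second term of the formula for
    [B'] adds the composites through [k], the last one reverses the arrows at
    [k].  The bound by 1 makes the supports of [i] and [o] disjoint, which is
    what allows them to be recovered from [B]. *)
Definition mutates k B B' : Prop := exists i o : V -> int,
  [/\ forall x, [/\ 0 <= i x, 0 <= o x & i x + o x <= 1],
      forall x, B k x = o x - i x
    & forall x y, B' x y = B x y + (i x * o y - o x * i y)
        - (ind (Some k) x * (o y - i y) - (o x - i x) * ind (Some k) y) *+ 2].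

Lemma ind_ge0 o x : 0 <= ind o x.
Proof. by case: o => [a|] /=; lia. Qed.

Lemma ind_self x : ind (Some x) x = 1.
Proof. by rewrite /= eqxx. Qed.

Lemma mutates_realizes Q B B' k :
  realizes Q B -> mutates k B B' -> realizes (mutate k Q) B'.
Proof.
move=> QB [i [o [io Bk B'E]]].
have Qk x : (Q x k)%:Z = i x /\ (Q k x)%:Z = o x.
  have := QB k x; have [h1 h2 h3] := io x; rewrite Bk.
  have [->|xk] := posnP (Q x k); last rewrite (quiver_no2cycle xk); lia.
have [ik ok] : i k = 0 /\ o k = 0.
  by have [<- <-] := Qk k; rewrite quiver_noloop.
move=> x y; rewrite B'E -QB /= /mutate_arrows /cancel_2cycles.
have -> (p q : nat) : (p - q)%N%:Z - (q - p)%N%:Z = p%:Z - q%:Z by lia.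
rewrite /reverse_at /add_composites.
have [ix ox] := Qk x; have [iy oy] := Qk y.
have [xk|xk] := eqVneq x k; have [yk|yk] := eqVneq y k;
  rewrite /= ?eqxx ?(negPf xk) ?(negPf yk) ?xk ?yk ?PoszD ?PoszM
    ?quiver_noloop ?ik ?ok;
  rewrite -?xk -?yk in ix ox iy oy ik ok *;
  rewrite ?ix ?ox ?iy ?oy ?ik ?ok; ring.
Qed.

Lemma mutates_ext k B B' D D' : mutates k B B' ->
  (forall x y, D x y = B x y) -> (forall x y, D' x y = B' x y) ->
  mutates k D D'.
Proof.
move=> [i [o [io Bk B'E]]] DB D'B; exists i, o; split=> // [x|x y].
  by rewrite DB.
by rewrite D'B B'E DB.
Qed.

(** Mutation at [k] ignores every part of the form that avoids [k]; this is
    what makes flips local. *)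
Lemma mutates_frame k B B' R : mutates k B B' -> (forall x, R k x = 0) ->
  mutates k (fun x y => B x y + R x y) (fun x y => B' x y + R x y).
Proof.
move=> [i [o [io Bk B'E]]] R0; exists i, o; split=> // [x|x y].
  by rewrite R0 addr0.
by rewrite B'E; ring.
Qed.

(** The flip of a diagonal [k] of a quadrilateral with sides a, b, c, d in
    cyclic order: the two triangles on either side of [k] are replaced by the
    two triangles on either side of the other diagonal. *)
Lemma mutates_flip k a b c d R B B' :
  (forall x, ind (Some k) x + ind a x + ind b x + ind c x + ind d x <= 1) ->
  (forall x, R k x = 0) ->
  (forall x y, B x y = tri (Some k) a b x y + tri (Some k) c d x y + R x y) ->
  (forall x y, B' x y = tri (Some k) b c x y + tri (Some k) d a x y + R x y) ->
  mutates k B B'.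
Proof.
move=> le1 R0 BE B'E; apply: mutates_ext BE B'E; apply: mutates_frame R0.
exists (fun x => ind b x + ind d x), (fun x => ind a x + ind c x).
have ge0 := ind_ge0.
split=> [x|x|x y].
- have := le1 x; have := ge0 (Some k) x; have := ge0 a x; have := ge0 b x.
  have := ge0 c x; have := ge0 d x; split; lia.
- have := le1 k; have := ge0 a k; have := ge0 b k; have := ge0 c k.
  have := ge0 d k; have := ind_self k; rewrite /tri /wedge => -> *.
  have [-> -> -> ->] : [/\ ind a k = 0, ind b k = 0, ind c k = 0 & ind d k = 0].
    by split; lia.
  ring.
- by rewrite /tri /wedge; ring.
Qed.
End Forms.

(** * Triangulated polygons as binary trees *)

(** A triangulated polygon with a distinguished side: [Leaf] is a boundary
    edge; in [Node l v r] the distinguished side is the arc [v], and [l] and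
    [r] lie beyond the other two sides of the triangle at [v]. *)
Inductive tree (V : Type) := Leaf | Node (l : tree V) (v : V) (r : tree V).
Arguments Leaf {V}.

Definition root_arc (V : Type) (T : tree V) : option V :=
  if T is Node _ v _ then Some v else None.

Section Trees.
Variable V : finType.
Implicit Types (T l r : tree V) (k p q v x y : V) (s : seq (V * tree V)).

(** Labels are counted rather than collected: that each vertex labels exactly
    one arc then becomes linear arithmetic. *)
Fixpoint tree_count T x : nat :=
  if T is Node l v r then ((x == v) + tree_count l x + tree_count r x)%N
  else 0%N.

Fixpoint tree_form T x y : int :=
  if T is Node l v r then
    tri (Some v) (root_arc l) (root_arc r) x y
    + tree_form l x y + tree_form r x y
  else 0.

Lemma ind_root_le T x : ind (root_arc T) x <= (tree_count T x)%:Z.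
Proof. by case: T => //= l v r; lia. Qed.

Lemma ind_root0 T x : tree_count T x = 0%N -> ind (root_arc T) x = 0.
Proof. by have := ind_root_le T x; have := ind_ge0 (root_arc T) x; lia. Qed.

Lemma ind_neq v x : x != v -> ind (Some v) x = 0.
Proof. by move=> /negPf /= ->. Qed.

Lemma tri0 (a b c : option V) x y :
  ind a x = 0 -> ind b x = 0 -> ind c x = 0 -> tri a b c x y = 0.
Proof. by rewrite /tri /wedge => -> -> ->; ring. Qed.

Lemma tree_form0 T x y : tree_count T x = 0%N -> tree_form T x y = 0.
Proof.
elim: T => //= l IHl v r IHr vlr.
rewrite IHl ?IHr ?tri0 ?ind_root0 ?ind_neq; lia.
Qed.

Lemma root_neq T k : tree_count T k = 0%N -> root_arc T <> Some k.
Proof.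
by case: T => //= a u b; case: eqVneq => //= ku _ [/esym]; apply/eqP.
Qed.

Lemma ind_root_neq T k : root_arc T <> Some k -> ind (root_arc T) k = 0.
Proof. by case: T => //= a u b; case: eqVneq => // ->. Qed.

End Trees.

(** Linear arithmetic on indicators of roots, each bounded by the number of
    occurrences in its tree.  The context is cleared, so the relevant
    hypotheses have to be in the goal. *)
Ltac root_lia :=
  rewrite /=; repeat match goal with |- context [ind (root_arc ?T) ?x] =>
    move: (ind_root_le T x); move: (ind (root_arc T) x) => ? end; clear; lia.

Section TreeFlips.
Variable V : finType.
Implicit Types (T l r : tree V) (k v x y : V).

(** Flipping an arc that lies strictly inside the polygon rotates the tree at
    that arc and its parent; the labels swap places with respect to the usual
    rotation because the parent arc stays where it is. *)
Lemma tree_mutates T k :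
  (forall x, tree_count T x <= 1)%N -> tree_count T k = 1%N ->
  root_arc T <> Some k ->
  exists T', [/\ root_arc T' = root_arc T,
    forall x, tree_count T' x = tree_count T x
    & mutates k (tree_form T) (tree_form T')].
Proof.
elim: T => //= l IHl v r IHr le1 cnt1 rootk.
have vk : k != v by apply/eqP => kv; case: rootk; rewrite kv.
rewrite (negPf vk) /= in cnt1.
have [[lk rk]|[lk rk]] : (tree_count l k = 1 /\ tree_count r k = 0)%N \/
               (tree_count l k = 0 /\ tree_count r k = 1)%N by lia.
- have [lroot|/eqP lroot] := eqVneq (root_arc l) (Some k).
  + case: l lroot {IHl} le1 cnt1 lk => //= a u b [->] le1 _; rewrite eqxx => lk.
    exists (Node a v (Node b k r)); split=> // [x /=|]; first by lia.
    apply: (@mutates_flip _ k (root_arc a) (root_arc b) (root_arc r) (Some v)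
      (fun x y => tree_form a x y + tree_form b x y + tree_form r x y)).
    * by move=> x; move: (le1 x); root_lia.
    * by move=> x; rewrite !tree_form0 ?addr0 //; lia.
    * by move=> x y /=; rewrite /tri; ring.
    by move=> x y /=; rewrite /tri; ring.
  have [x|//|l' [rl cl ml]] := IHl _ lk; first by have := le1 x; lia.
  exists (Node l' v r); split=> //= [x|]; first by rewrite cl.
  rewrite rl; apply: mutates_ext (mutates_frame ml (R := fun x y =>
    tri (Some v) (root_arc l) (root_arc r) x y + tree_form r x y) _) _ _ => x *.
  * by rewrite tri0 ?tree_form0 ?ind_neq ?ind_root_neq //; apply: root_neq.
  * by ring.
  by ring.
have [rroot|/eqP rroot] := eqVneq (root_arc r) (Some k).
- case: r rroot {IHr} le1 cnt1 rk => //= a u b [->] le1 _; rewrite eqxx => rk.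
  exists (Node (Node l k a) v b); split=> // [x /=|]; first by lia.
  apply: (@mutates_flip _ k (root_arc a) (root_arc b) (Some v) (root_arc l)
    (fun x y => tree_form a x y + tree_form b x y + tree_form l x y)).
  + by move=> x; move: (le1 x); root_lia.
  + by move=> x; rewrite !tree_form0 ?addr0 //; lia.
  + by move=> x y /=; rewrite /tri; ring.
  by move=> x y /=; rewrite /tri; ring.
have [x|//|r' [rr cr mr]] := IHr _ rk; first by have := le1 x; lia.
exists (Node l v r'); split=> //= [x|]; first by rewrite cr.
rewrite rr; apply: mutates_ext (mutates_frame mr (R := fun x y =>
  tri (Some v) (root_arc l) (root_arc r) x y + tree_form l x y) _) _ _ => x *.
- by rewrite tri0 ?tree_form0 ?ind_neq ?ind_root_neq //; apply: root_neq.
- by ring.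
by ring.
Qed.
End TreeFlips.

(** * Triangulations of a punctured polygon *)

(** [Fork p q T U]: the parallel arcs [p], [q] to the puncture, in a digon with
    [T] and [U] beyond its sides.  [Wheel s]: the arcs to the puncture in
    cyclic order, each with the polygon beyond the triangle that it forms with
    the next one. *)
Inductive triangulation (V : Type) :=
| Fork (p q : V) (T U : tree V)
| Wheel (s : seq (V * tree V)).

Section Triangulations.
Variable V : finType.
Implicit Types (T U l r : tree V) (k p q v x y : V) (s : seq (V * tree V)).
Implicit Types (S : triangulation V).

(** The parallel arcs lie in triangles with the same two other sides, whose
    common arrow is counted once. *)
Definition fork_form p q T U x y : int :=
  wedge (Some p) (root_arc T) x y + wedge (Some q) (root_arc T) x y
  + wedge (root_arc T) (root_arc U) x y
  + wedge (root_arc U) (Some p) x y + wedge (root_arc U) (Some q) x y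
  + tree_form T x y + tree_form U x y.

(** The triangles of a linear stretch of a wheel; [z] is the arc to the
    puncture that follows the last listed one. *)
Fixpoint fan_form z s x y : int :=
  if s is (p, T) :: s' then
    tri (Some p) (root_arc T) (Some (head z (unzip1 s'))) x y + tree_form T x y
    + fan_form z s' x y
  else 0.

Definition wheel_form s : V -> V -> int :=
  if s is (p, _) :: _ then fan_form p s else fun _ _ => 0.

Definition form S : V -> V -> int :=
  match S with
  | Fork p q T U => fork_form p q T U
  | Wheel s => wheel_form s
  end.

Fixpoint fan_count s x : nat :=
  if s is (p, T) :: s' then ((x == p) + tree_count T x + fan_count s' x)%N
  else 0%N.

Definition label_count S x : nat :=
  match S with
  | Fork p q T U => ((x == p) + (x == q) + tree_count T x + tree_count U x)%N
  | Wheel s => fan_count s x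
  end.

(** With a single arc to the puncture there is no such wheel: it is a fork. *)
Definition admissible S : bool :=
  if S is Wheel s then (1 < size s)%N else true.

Definition spanning S : Prop := admissible S /\ forall x, label_count S x = 1%N.

Lemma fan_form_cat z s1 s2 x y :
  fan_form z (s1 ++ s2) x y =
  fan_form (head z (unzip1 s2)) s1 x y + fan_form z s2 x y.
Proof.
elim: s1 => [|[p T] s1 IH] /=; first by rewrite add0r.
by rewrite IH; case: s1 {IH} => [|[q U] s1] /=; ring.
Qed.

Lemma wheel_form_rot s1 s2 x y :
  wheel_form (s1 ++ s2) x y = wheel_form (s2 ++ s1) x y.
Proof.
case: s1 s2 => [|[p T] s1] [|[q U] s2] //; first by rewrite cats0.
  by rewrite cats0.
rewrite /wheel_form cat_cons [in RHS]cat_cons -!cat_cons.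
by rewrite !fan_form_cat /= addrC.
Qed.

Lemma fan_count_cat s1 s2 x :
  fan_count (s1 ++ s2) x = (fan_count s1 x + fan_count s2 x)%N.
Proof. by elim: s1 => [|[p T] s1 IH] //=; rewrite IH; lia. Qed.

Lemma fan_count_mem s k : fan_count s k = 1%N ->
  exists s1 p T s2, s = s1 ++ (p, T) :: s2 /\ (k = p \/ tree_count T k = 1%N).
Proof.
elim: s => [|[p T] s IH] //= cnt.
have [kp|kp] := eqVneq k p; first by exists [::], p, T, s; split; last left.
have [Tk|Tk] : tree_count T k = 1%N \/ fan_count s k = 1%N.
- by rewrite (negPf kp) in cnt; lia.
- by exists [::], p, T, s; split; last right.
have [s1 [p' [T' [s2 [-> h]]]]] := IH Tk.
by exists ((p, T) :: s1), p', T', s2.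
Qed.

Lemma fan_form0 z s k x : fan_count s k = 0%N -> k != z ->
  fan_form z s k x = 0.
Proof.
elim: s => [|[p T] s IH] //= cnt kz; rewrite IH //; last by lia.
rewrite tree_form0 ?tri0 ?ind_root0 ?ind_neq //; try lia.
by case: s {IH} cnt => [|[q U] s] //=; lia.
Qed.

(** A fork and a wheel with two arcs differ by the flip of one arc to the
    puncture.  This is not the flip of a quadrilateral: in the wheel the two
    triangles at [q] share the side [p], and the two arrows between [p] and [q]
    cancel. *)
Lemma fork_mutates p q T U : (forall x, label_count (Fork p q T U) x <= 1)%N ->
  mutates q (form (Fork p q T U)) (form (Wheel [:: (p, T); (q, U)])).
Proof.
move=> le1; have := le1 q; rewrite /= eqxx => cq.
exists (ind (root_arc U)), (ind (root_arc T)); split=> [x|x|x y] /=.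
- have := ind_ge0 (root_arc T) x; have := ind_ge0 (root_arc U) x.
  by split=> //; move: (le1 x); root_lia.
- rewrite /fork_form /wedge ?ind_self !(@tree_form0 _ _ q) ?(@ind_root0 _ _ q)
    ?(@ind_neq _ p q) //;
  try lia; ring.
rewrite /fork_form /tri /wedge; ring.
Qed.

Lemma digon_mutates p q T U : (forall x, label_count (Fork p q T U) x <= 1)%N ->
  mutates q (form (Wheel [:: (p, T); (q, U)])) (form (Fork p q T U)).
Proof.
move=> le1; have := le1 q; rewrite /= eqxx => cq.
exists (ind (root_arc T)), (ind (root_arc U)); split=> [x|x|x y] /=.
- have := ind_ge0 (root_arc T) x; have := ind_ge0 (root_arc U) x.
  by split=> //; move: (le1 x); root_lia.
- rewrite /tri /wedge ?ind_self !(@tree_form0 _ _ q) ?(@ind_root0 _ _ q)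
    ?(@ind_neq _ p q) //;
  try lia; ring.
rewrite /fork_form /tri /wedge; ring.
Qed.

(** Flipping a side of the digon of a fork is a rotation once the pair of
    parallel arcs is regarded as the root of a tree with subtrees [T], [U]. *)
Lemma fork_left_root_mutates p q l k r U :
  (forall x, label_count (Fork p q (Node l k r) U) x <= 1)%N ->
  mutates k (form (Fork p q (Node l k r) U)) (form (Fork p q l (Node r k U))).
Proof.
move=> le1; have := le1 k; rewrite /= eqxx => ck.
have [kp kq] : (k == p) = false /\ (k == q) = false by split; lia.
exists (fun x => ind (root_arc r) x + ind (Some p) x + ind (Some q) x),
  (fun x => ind (root_arc l) x + ind (root_arc U) x); split=> [x|x|x y] /=.
- have := ind_ge0 (root_arc l) x; have := ind_ge0 (root_arc U) x.
  have := ind_ge0 (root_arc r) x; split; try lia.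
  by move: (le1 x); root_lia.
- rewrite /fork_form /= /tri /wedge /= kp kq eqxx !(@tree_form0 _ _ k)
    ?(@ind_root0 _ _ k) /=;
  try lia; ring.
rewrite /fork_form /= /tri /wedge /=; ring.
Qed.

Lemma fork_right_root_mutates p q l k r T :
  (forall x, label_count (Fork p q T (Node l k r)) x <= 1)%N ->
  mutates k (form (Fork p q T (Node l k r))) (form (Fork p q (Node T k l) r)).
Proof.
move=> le1; have := le1 k; rewrite /= eqxx => ck.
have [kp kq] : (k == p) = false /\ (k == q) = false by split; lia.
exists (fun x => ind (root_arc r) x + ind (root_arc T) x),
  (fun x => ind (root_arc l) x + ind (Some p) x + ind (Some q) x);
  split=> [x|x|x y] /=.
- have := ind_ge0 (root_arc l) x; have := ind_ge0 (root_arc T) x.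
  have := ind_ge0 (root_arc r) x; split; try lia.
  by move: (le1 x); root_lia.
- rewrite /fork_form /= /tri /wedge /= kp kq eqxx !(@tree_form0 _ _ k)
    ?(@ind_root0 _ _ k) /=;
  try lia; ring.
rewrite /fork_form /= /tri /wedge /=; ring.
Qed.

Lemma fork_step p q T U k : spanning (Fork p q T U) ->
  exists S', spanning S' /\ mutates k (form (Fork p q T U)) (form S').
Proof.
case=> _ /= cnt.
have le1 x : (label_count (Fork p q T U) x <= 1)%N by rewrite /= cnt.
have [kq|kq] := eqVneq k q.
  rewrite kq; exists (Wheel [:: (p, T); (q, U)]); split.
    2: exact: fork_mutates.
  by split=> //= x; have := cnt x; lia.
have [kp|kp] := eqVneq k p.
  rewrite kp; exists (Wheel [:: (q, T); (p, U)]); split.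
    by split=> //= x; have := cnt x; lia.
  have := @fork_mutates q p T U; case=> [x|].
    by have := cnt x; rewrite /=; lia.
  move=> i [o io]; exists i, o; move: io => [h1 h2 h3]; split=> // x *.
    by rewrite -h2 /= /fork_form; ring.
  by rewrite h3 /= /fork_form; ring.
have [[Tk Uk]|[Tk Uk]] : (tree_count T k = 1 /\ tree_count U k = 0)%N \/
    (tree_count T k = 0 /\ tree_count U k = 1)%N.
- by have := cnt k; rewrite (negPf kp) (negPf kq); lia.
- have [Troot|/eqP Troot] := eqVneq (root_arc T) (Some k).
    case: T Troot cnt le1 {Tk} => //= l v r [->] cnt le1.
    exists (Fork p q l (Node r k U)); split; last exact: fork_left_root_mutates.
    by split=> //= x; have := cnt x; lia.
  have [x|//|T' [rT cT mT]] := tree_mutates _ Tk; first by have := cnt x; lia.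
  exists (Fork p q T' U); split; first by split=> //= x; rewrite cT.
  apply: mutates_ext (mutates_frame mT (R := fun x y =>
    fork_form p q T U x y - tree_form T x y) _) _ _ => x *.
  + rewrite /fork_form /wedge !(tree_form0 _ Uk) (ind_neq kp) (ind_neq kq).
    by rewrite (ind_root_neq Troot) (ind_root0 Uk); ring.
  + by rewrite /=; ring.
  by rewrite /= /fork_form rT; ring.
have [Uroot|/eqP Uroot] := eqVneq (root_arc U) (Some k).
  case: U Uroot cnt le1 {Uk} => //= l v r [->] cnt le1.
  exists (Fork p q (Node T k l) r); split; last exact: fork_right_root_mutates.
  by split=> //= x; have := cnt x; lia.
have [x|//|U' [rU cU mU]] := tree_mutates _ Uk; first by have := cnt x; lia.
exists (Fork p q T U'); split; first by split=> //= x; rewrite cU.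
apply: mutates_ext (mutates_frame mU (R := fun x y =>
  fork_form p q T U x y - tree_form U x y) _) _ _ => x *.
+ rewrite /fork_form /wedge !(tree_form0 _ Tk) (ind_neq kp) (ind_neq kq).
  by rewrite (ind_root_neq Uroot) (ind_root0 Tk); ring.
+ by rewrite /=; ring.
by rewrite /= /fork_form rU; ring.
Qed.

(** Flipping the side that cuts off [T] from the wheel makes it an arc to the
    puncture; a flip further inside [T] is a rotation. *)
Lemma wheel_side_step p T s k : spanning (Wheel ((p, T) :: s)) ->
  tree_count T k = 1%N ->
  exists S', spanning S' /\ mutates k (wheel_form ((p, T) :: s)) (form S').
Proof.
case=> /=; case: s => [|[q U] s] //= _ cnt Tk.
have := cnt k; rewrite Tk => ck.
have [kp kq] : k != p /\ k != q by lia.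
have fan0 x : fan_form p ((q, U) :: s) k x = 0 by rewrite fan_form0 /=; lia.
have Uk : tree_count U k = 0%N by lia.
have sk : fan_count s k = 0%N by lia.
rewrite /= in fan0.
have [Troot|/eqP Troot] := eqVneq (root_arc T) (Some k).
  case: T Troot Tk cnt ck => //= l v r [->]; rewrite eqxx => Tk cnt ck.
  exists (Wheel [:: (p, l), (k, r), (q, U) & s]); split.
    by split=> //= x; have := cnt x; lia.
  apply: (@mutates_flip _ k (root_arc l) (root_arc r) (Some q) (Some p)
   (fun x y => tree_form l x y + tree_form r x y
       + fan_form p ((q, U) :: s) x y)) => [x|x|x y|x y] /=.
  + by move: (cnt x); root_lia.
  + rewrite fan0 !tree_form0; lia.
  + by rewrite /tri; ring.
  by rewrite /tri; ring.
have [x|//|T' [rT cT mT]] := tree_mutates _ Tk; first by have := cnt x; lia.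
exists (Wheel [:: (p, T'), (q, U) & s]); split.
  by split=> //= x; rewrite cT; have := cnt x; lia.
apply: mutates_ext (mutates_frame mT (R := fun x y =>
  tri (Some p) (root_arc T) (Some q) x y + fan_form p ((q, U) :: s) x y) _) _ _
  => [x|x y|x y] /=.
- by rewrite fan0 tri0 ?(ind_root_neq Troot) ?ind_neq //; ring.
- by ring.
by rewrite rT; ring.
Qed.

(** Flipping an arc to the puncture merges the polygons on its two sides, or
    yields a fork when only one other such arc is left. *)
Lemma wheel_spoke_step p T k U s : spanning (Wheel [:: (p, T), (k, U) & s]) ->
  exists S', spanning S' /\
    mutates k (wheel_form [:: (p, T), (k, U) & s]) (form S').
Proof.
case=> _; case: s => [|[q W] s] cnt.
  exists (Fork p k T U); split.
    by split=> //= x; have /= := cnt x; lia.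
  by apply: digon_mutates => x; have /= := cnt x; lia.
exists (Wheel [:: (p, Node T k U), (q, W) & s]); split.
  by split=> //= x; have /= := cnt x; lia.
have /= := cnt k; rewrite eqxx => ck.
apply: (@mutates_flip _ k (root_arc U) (Some q) (Some p) (root_arc T)
   (fun x y => tree_form T x y + tree_form U x y
       + fan_form p ((q, W) :: s) x y)) => [x|x|x y|x y] /=.
- by move: (cnt x); root_lia.
- rewrite !tree_form0 ?tri0 ?ind_root0 ?ind_neq ?fan_form0; try lia.
  by case: s {cnt} ck => [|[r X] s] /=; lia.
- by rewrite /tri; ring.
by rewrite /tri; ring.
Qed.

Lemma spanning_rot s1 s2 :
  spanning (Wheel (s1 ++ s2)) -> spanning (Wheel (s2 ++ s1)).
Proof.
move=> [pr cnt]; split=> [|x]; rewrite /= in pr *.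
  by move: pr; rewrite !size_cat addnC.
by have := cnt x; rewrite /= !fan_count_cat addnC.
Qed.

Lemma wheel_step s k : spanning (Wheel s) ->
  exists S', spanning S' /\ mutates k (wheel_form s) (form S').
Proof.
move=> span; have [pr cnt] := span.
have [s1 [p [T [s2 [defs kin]]]]] := fan_count_mem (cnt k).
move: span pr {cnt}; rewrite defs => span pr.
have rot B s' s'' : mutates k (wheel_form (s' ++ s'')) B ->
    mutates k (wheel_form (s'' ++ s')) B.
  by move=> h; apply: mutates_ext h _ _ => // x y; rewrite wheel_form_rot.
(* The wheel has no first arc: rotate it to put k where the lemmas expect it. *)
case: kin => [kp|kT]; last first.
  have [S' [sS mS]] := wheel_side_step (spanning_rot span) kT.
  by exists S'; split=> //; apply: rot.
have := spanning_rot span; rewrite -kp /= => {}span.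
have nonnil : (0 < size (s2 ++ s1))%N.
  by move: pr; rewrite /= !size_cat /= addnS ltnS addnC.
have E x y : wheel_form (s1 ++ (k, T) :: s2) x y =
             wheel_form ((k, T) :: (s2 ++ s1)) x y.
  by rewrite wheel_form_rot.
case: (lastP (s2 ++ s1)) nonnil E span => [|s' [q U]] // _ E.
rewrite -cats1 -cat_cons => /spanning_rot/wheel_spoke_step[S' [sS mS]].
exists S'; split=> //; apply: mutates_ext mS _ _ => // x y.
by rewrite E -cats1 -cat_cons wheel_form_rot.
Qed.

Lemma triangulation_mutates S k : spanning S ->
  exists S', spanning S' /\ mutates k (form S) (form S').
Proof. by case: S => [p q T U|s]; [apply: fork_step | apply: wheel_step]. Qed.
End Triangulations.

(** * Orientations of the Dynkin diagram D *)

Section DynkinD.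
Variables (m : nat) (D : quiver 'I_m.+3).
Hypothesis orD : is_orientation (@dynkinD m.+3) D.
Implicit Types x y : 'I_m.+3.

Let v j : 'I_m.+3 := inord j.

(** The vertices 0, ..., m form the long arm up to the branch vertex m.  A path
    is a tree without branching; an arrow between v and its only child points
    to the child exactly when that is the left child. *)
Fixpoint path_tree j : tree 'I_m.+3 :=
  if j is j'.+1 then
    if D (v j'.+1) (v j') == 1%N then Node (path_tree j') (v j) Leaf
    else Node Leaf (v j) (path_tree j')
  else Node Leaf (v 0) Leaf.

Let vE j x : (j <= m.+2)%N -> (x == v j) = (x == j :> nat).
Proof. by move=> jm; rewrite -val_eqE /= inordK. Qed.

Lemma root_path_tree j : root_arc (path_tree j) = Some (v j).
Proof. by case: j => //= j; case: ifP. Qed.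

Lemma path_tree_count j x :
  (j <= m)%N -> tree_count (path_tree j) x = (x <= j)%N.
Proof.
elim: j => [|j IH] jm /=; first by rewrite vE //; lia.
by case: ifP => _ /=; rewrite IH ?vE //; lia.
Qed.

Lemma dynkinD_nonadjacent x y : ~~ dynkinD x y -> D x y = 0%N /\ D y x = 0%N.
Proof.
move=> /negPf xy; have := orD x y; rewrite xy => /eqP.
by rewrite addn_eq0 => /andP[/eqP-> /eqP->].
Qed.

Lemma path_tree_form j x y : (j <= m)%N ->
  tree_form (path_tree j) x y =
  if (x <= j)%N && (y <= j)%N then (D x y)%:Z - (D y x)%:Z else 0.
Proof.
elim: j => [|j IH] jm.
  rewrite /= /tri /wedge /= !vE //.
  case: ifP => [/andP[x0 y0]|_]; last by ring.
  have -> : x = y by apply: val_inj => /=; lia.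
  by ring.
have orj : (D (v j.+1) (v j) + D (v j) (v j.+1) = 1)%N.
  by rewrite orD /dynkinD /dynkinD_half !inordK; lia.
have -> : tree_form (path_tree j.+1) x y =
   ((D (v j.+1) (v j))%:Z - (D (v j) (v j.+1))%:Z) *
      wedge (Some (v j.+1)) (Some (v j)) x y + tree_form (path_tree j) x y.
  rewrite /=; case: eqP => [D1|D1] /=; rewrite root_path_tree /tri /wedge /=.
    have -> : D (v j) (v j.+1) = 0%N by lia.
    by rewrite D1; ring.
  have -> : D (v j.+1) (v j) = 0%N by lia.
  have -> : D (v j) (v j.+1) = 1%N by lia.
  by ring.
rewrite {}IH; last by lia.
rewrite /wedge /= !vE; try lia.
have vx i (z : 'I_m.+3) : z = i :> nat -> (i <= m)%N -> z = v i.
  by move=> zi im; apply/eqP; rewrite vE; lia.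
have [xj|xj] := eqVneq (x : nat) j.+1; have [yj|yj] := eqVneq (y : nat) j.+1.
- rewrite (vx _ _ xj) // (vx _ _ yj) // !inordK ?ltnn; try lia.
  by rewrite leqnn /=; ring.
- have -> : (x == j :> nat) = false by lia.
  have -> : (x <= j)%N = false by lia.
  have -> : (x <= j.+1)%N = true by lia.
  have [yj'|yj'] := eqVneq (y : nat) j.
    rewrite (vx _ _ xj) // (vx _ _ yj') ?inordK /=; try lia.
    by rewrite leqnSn; ring.
  case: ifP => h; last by rewrite /=; ring.
  have [|D1 D2] := @dynkinD_nonadjacent y x.
    by rewrite /dynkinD /dynkinD_half; lia.
  by rewrite D1 D2 /=; ring.
- have -> : (y == j :> nat) = false by lia.
  have -> : (y <= j)%N = false by lia.
  have -> : (y <= j.+1)%N = true by lia.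
  rewrite andbF.
  have [xj'|xj'] := eqVneq (x : nat) j.
    rewrite (vx _ _ yj) // (vx _ _ xj') ?inordK /=; try lia.
    by rewrite leqnSn; ring.
  case: ifP => h; last by rewrite /=; ring.
  have [|D1 D2] := @dynkinD_nonadjacent x y.
    by rewrite /dynkinD /dynkinD_half; lia.
  by rewrite D1 D2 /=; ring.
have -> : (x <= j.+1)%N = (x <= j)%N by lia.
have -> : (y <= j.+1)%N = (y <= j)%N by lia.
by rewrite /=; ring.
Qed.

Let p := v m.+1.
Let q := v m.+2.
Let b := v m.

(** The branch vertex b is the root of a path tree that is placed according to
    the arrows between b and the two short arms p, q: a fork when both arrows
    point the same way with respect to b, a wheel when p -> b -> q or
    q -> b -> p. *)
Lemma dynkin_spanning : exists S, spanning S /\ realizes D (form S).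
Proof.
have orp : (D p b + D b p = 1)%N.
  by rewrite orD /dynkinD /dynkinD_half !inordK; lia.
have orq : (D q b + D b q = 1)%N.
  by rewrite orD /dynkinD /dynkinD_half !inordK; lia.
pose E x y : int := ((D p b)%:Z - (D b p)%:Z) * wedge (Some p) (Some b) x y
  + ((D q b)%:Z - (D b q)%:Z) * wedge (Some q) (Some b) x y
  + tree_form (path_tree m) x y.
have DE : realizes D E.
  move=> x y; rewrite /E path_tree_form // /wedge /= !vE //; try lia.
  have vx i (z : 'I_m.+3) : z = i :> nat -> (i <= m.+2)%N -> z = v i.
    by move=> zi im; apply/eqP; rewrite vE; lia.
  have D0 z : D z z = 0%N by apply: quiver_noloop.
  have leaf w i : (m < i <= m.+2)%N -> (D (v i) w)%:Z - (D w (v i))%:Z =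
      ((D (v i) b)%:Z - (D b (v i))%:Z) * ((w == m :> nat) : nat)%:Z.
    move=> im; have [wm|wm] := eqVneq (w : nat) m.
      by rewrite (vx _ _ wm) ?mulr1 //; lia.
    have [wi|wi] := eqVneq (w : nat) i.
      by rewrite (vx _ _ wi) ?D0 ?mulr0 ?subrr //; lia.
    have [|-> ->] := @dynkinD_nonadjacent (v i) w.
    2: by rewrite /= mulr0 subrr.
    by rewrite /dynkinD /dynkinD_half !inordK; lia.
  have cmp (z : 'I_m.+3) : [\/ (z <= m)%N, z = m.+1 :> nat | z = m.+2 :> nat].
    have := ltn_ord z; have [zm|zm] := leqP z m; first by constructor 1.
    have [zm1|zm1] := eqVneq (z : nat) m.+1; first by constructor 2.
    by constructor 3; lia.
  have small (z : 'I_m.+3) i :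
      (z <= m)%N -> (m < i)%N -> (z == i :> nat) = false by lia.
  have big i : (m < i)%N -> (i == m) = false /\ (i <= m)%N = false by lia.
  have [m1 m2] : (m < m.+1 /\ m < m.+2)%N by lia.
  have [n1 n2] : (m.+1 == m.+2) = false /\ (m.+2 == m.+1) = false by lia.
  have [[e1 l1] [e2 l2]] := (big _ m1, big _ m2).
  case: (cmp x) => hx; last 2 first.
  - rewrite {1 2}(vx _ _ hx) // leaf ?m1 // -/p.
    by rewrite hx e1 l1 n1 eqxx /=; ring.
  - rewrite {1 2}(vx _ _ hx) // leaf ?m2 // -/q.
    by rewrite hx e2 l2 n2 eqxx /=; ring.
  rewrite hx !(small _ _ hx m1) !(small _ _ hx m2).
  case: (cmp y) => hy; last 2 first.
  - rewrite -opprB {1 2}(vx _ _ hy) // leaf ?m1 // -/p.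
    by rewrite hy e1 l1 n1 eqxx /=; ring.
  - rewrite -opprB {1 2}(vx _ _ hy) // leaf ?m2 // -/q.
    by rewrite hy e2 l2 n2 eqxx /=; ring.
  by rewrite hy !(small _ _ hy m1) !(small _ _ hy m2) /=; ring.
have cnt x : ((x == p) + (x == q) + tree_count (path_tree m) x = 1)%N.
  by rewrite path_tree_count // !vE //; have := ltn_ord x; lia.
have rT := root_path_tree m.
have [[D1 D2]|[D1 D2]] :
  (D p b = 1 /\ D b p = 0)%N \/ (D p b = 0 /\ D b p = 1)%N.
- by lia.
- have [[D3 D4]|[D3 D4]] :
    (D q b = 1 /\ D b q = 0)%N \/ (D q b = 0 /\ D b q = 1)%N.
  + by lia.
  + exists (Fork p q (path_tree m) Leaf); split.
      by split=> // x /=; rewrite cnt.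
    move=> x y; rewrite DE /E /= /fork_form rT D1 D2 D3 D4 /wedge /=; ring.
  exists (Wheel [:: (p, path_tree m); (q, Leaf)]); split.
    by split=> // x /=; rewrite -[RHS](cnt x); ring.
  move=> x y; rewrite DE /E /= rT D1 D2 D3 D4 /tri /wedge /=; ring.
have [[D3 D4]|[D3 D4]] :
    (D q b = 1 /\ D b q = 0)%N \/ (D q b = 0 /\ D b q = 1)%N.
- by lia.
- exists (Wheel [:: (q, path_tree m); (p, Leaf)]); split.
    by split=> // x /=; rewrite -[RHS](cnt x); ring.
  move=> x y; rewrite DE /E /= rT D1 D2 D3 D4 /tri /wedge /=; ring.
exists (Fork p q Leaf (path_tree m)); split.
  by split=> // x /=; rewrite -[RHS](cnt x); ring.
move=> x y; rewrite DE /E /= /fork_form rT D1 D2 D3 D4 /wedge /=; ring.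
Qed.
End DynkinD.

(** * Trees of chains *)

Section Layouts.
Variable V : finType.
Implicit Types (B : V -> V -> int) (a b c d : seq V) (chs : seq (seq V)).
Implicit Types (l : seq (V * V)) (p q u v x y : V).
Implicit Types (T U : tree V) (s : seq (V * tree V)).

(** A list of ordered pairs stands for the arrows from first to second
    component. *)
Definition arrows_form l x y : int :=
  (count_mem (x, y) l)%:Z - (count_mem (y, x) l)%:Z.

(** A chain lists v_1, v_2, ..., from the bottom up, while the vertical arrows
    go from v_(l+1) to v_l. *)
Definition descents c : seq (V * V) := zip (behead c) c.

(** The path a_1 -> b_1 -> a_2 -> b_2 -> ... *)
Definition zigzag a b : seq (V * V) := zip a b ++ zip b (behead a).

Definition chain B c : Prop :=
  forall x y, x \in c -> y \in c -> B x y = arrows_form (descents c) x y.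

Definition oblique B c d : Prop := exists a b,
  [/\ subseq a c, subseq b d, (size b <= size a <= (size b).+1)%N
    & forall x y, x \in c -> y \in d -> B x y = arrows_form (zigzag a b) x y].

(** Each chain is joined to at most one chain further down the list. *)
Inductive chain_tree B : seq (seq V) -> Prop :=
| ChainTree1 c : c != [::] -> chain B c -> chain_tree B [:: c]
| ChainTreeCons c d chs :
    chain_tree B chs -> c \in chs -> d != [::] -> chain B d ->
    oblique B c d \/ oblique B d c ->
    (forall x y, x \in d -> y \in flatten chs -> y \notin c -> B x y = 0) ->
    chain_tree B (d :: chs).

Definition layout B chs : Prop :=
  [/\ chain_tree B chs, uniq (flatten chs),
      forall x y, B x y = - B y x
    & forall x y, x \notin flatten chs -> B x y = 0].

Lemma mem_flatten x c chs : x \in c -> c \in chs -> x \in flatten chs.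
Proof. by move=> xc cC; apply/flattenP; exists c. Qed.

Lemma arrows_form_cons u v l x y : arrows_form ((u, v) :: l) x y =
  wedge (Some u) (Some v) x y + arrows_form l x y.
Proof.
rewrite /arrows_form /wedge /= !xpair_eqE !(eq_sym _ x) !(eq_sym _ y) !PoszD.
by case: (x == u); case: (x == v); case: (y == u); case: (y == v) => /=; ring.
Qed.

Lemma arrows_form_skew l x y : arrows_form l x y = - arrows_form l y x.
Proof. by rewrite /arrows_form; lia. Qed.

Lemma arrows_form0 l x y :
  (x, y) \notin l -> (y, x) \notin l -> arrows_form l x y = 0.
Proof. by rewrite /arrows_form => /count_memPn-> /count_memPn->. Qed.

Lemma mem_zip (a b : seq V) x y : (x, y) \in zip a b -> x \in a /\ y \in b.
Proof.
elim: a b => [|u a IH] [|v b] //=; rewrite !inE xpair_eqE.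
by case/orP=> [/andP[-> ->]|/IH[-> ->]]; rewrite ?orbT.
Qed.

Lemma descents_mem c x y : (x, y) \in descents c -> x \in c /\ y \in c.
Proof. by case/mem_zip => /mem_behead. Qed.

Lemma zigzag_mem a b x y : (x, y) \in zigzag a b ->
  (x \in a /\ y \in b) \/ (x \in b /\ y \in a).
Proof.
rewrite mem_cat => /orP[/mem_zip|/mem_zip[xb /mem_behead]]; first by left.
by right.
Qed.

Lemma chain_tree_ext B B' chs : chain_tree B chs ->
  (forall x y, x \in flatten chs -> y \in flatten chs -> B' x y = B x y) ->
  chain_tree B' chs.
Proof.
elim=> [c c0 cB|c d {}chs chsB IH cC d0 dB obl far] BB'.
  rewrite /= cats0 in BB'; apply: ChainTree1 => // x y xc yc.
  by rewrite BB' ?cB.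
have cS x : x \in c -> x \in flatten (d :: chs).
  by move=> xc; rewrite /= mem_cat (mem_flatten xc cC) orbT.
have dS x : x \in d -> x \in flatten (d :: chs) by rewrite /= mem_cat => ->.
have fS x : x \in flatten chs -> x \in flatten (d :: chs).
  by rewrite /= mem_cat orbC => ->.
apply: (ChainTreeCons (c := c)) => //.
- by apply: IH => x y xf yf; rewrite BB' ?fS.
- by move=> x y xd yd; rewrite BB' ?dS ?dB.
- case: obl => -[a [b [ac bd sz E]]]; [left|right];
    exists a, b; split=> // x y xh yh.
    by rewrite BB' ?E ?(cS _ xh) ?(dS _ yh).
  by rewrite BB' ?E ?(dS _ xh) ?(cS _ yh).
by move=> x y xd yf yc; rewrite BB' ?(dS _ xd) ?(fS _ yf) //; apply: far.
Qed.

Lemma layout_ext B B' chs : layout B chs -> (forall x y, B' x y = B x y) ->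
  layout B' chs.
Proof.
move=> [ch un sk su] BB'; split=> // [|x y|x y xf].
- by apply: chain_tree_ext ch _ => x y _ _.
- by rewrite !BB' sk.
by rewrite BB' su.
Qed.

Lemma layout1 c : c != [::] -> uniq c ->
  layout (arrows_form (descents c)) [:: c].
Proof.
move=> c0 cu; split=> /= [|||x y]; rewrite ?cats0 //.
- by apply: ChainTree1.
- by move=> x y; apply: arrows_form_skew.
move=> xc; apply: arrows_form0; apply: contra xc => /descents_mem; by case.
Qed.

(** The form added here consists of arrows inside the new chain [d] and of one
    zigzag between [d] and the old chain [c]; either of the two may be the
    chain in which the zigzag starts. *)
Lemma layout_cons B chs c d a b :
  layout B chs -> c \in chs -> d != [::] -> uniq d ->
  (forall x, x \in d -> x \notin flatten chs) ->
  (size b <= size a <= (size b).+1)%N ->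
  (subseq a c && subseq b d) || (subseq a d && subseq b c) ->
  layout (fun x y => B x y +
    (arrows_form (descents d) x y + arrows_form (zigzag a b) x y)) (d :: chs).
Proof.
move=> [ch un sk su] cC d0 du dis sz sub.
have dis' x : x \in flatten chs -> x \notin d.
  by move=> xf; apply/negP => /dis; rewrite xf.
have disc x : x \in c -> x \notin d.
  by move=> xc; apply: dis'; apply: mem_flatten xc cC.
have zig0 x y : ~~ ((x \in c) && (y \in d)) -> ~~ ((x \in d) && (y \in c)) ->
    arrows_form (zigzag a b) x y = 0.
  move=> h1 h2; have key u v : (u, v) \in zigzag a b ->
      (u \in c) && (v \in d) || (u \in d) && (v \in c).
    case/zigzag_mem => -[ua vb];
    case/orP: sub => /andP[/mem_subseq sa /mem_subseq sb];
    by rewrite (sa _ ua) (sb _ vb) ?orbT || rewrite (sa _ vb) (sb _ ua) ?orbT.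
  apply: arrows_form0; apply/negP => /key.
    by rewrite (negPf h1) (negPf h2).
  by rewrite andbC (negPf h2) andbC (negPf h1).
have desc0 x y :
  ~~ ((x \in d) && (y \in d)) -> arrows_form (descents d) x y = 0.
  move=> h; apply: arrows_form0; apply/negP => /descents_mem[xd yd];
  by rewrite xd yd in h.
split.
- apply: (ChainTreeCons (c := c)) => //.
  + apply: chain_tree_ext ch _ => x y xf yf.
    rewrite desc0 ?zig0 ?addr0 ?(negPf (dis' _ xf)) //.
    by rewrite (negPf (dis' _ yf)) andbF.
  + move=> x y xd yd; rewrite su ?dis // add0r zig0 ?addr0 //.
      by apply/negP => /andP[/disc]; rewrite xd.
    by apply/negP => /andP[_ /disc]; rewrite yd.
  + have tail x y : (x \in c) && (y \in d) || (x \in d) && (y \in c) ->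
      B x y + (arrows_form (descents d) x y + arrows_form (zigzag a b) x y)
      = arrows_form (zigzag a b) x y.
      case/orP=> /andP[h1 h2].
        rewrite sk su ?dis // desc0 ?oppr0 ?add0r //.
        by rewrite (negPf (disc _ h1)).
      rewrite su ?dis // desc0 ?add0r //.
      by rewrite (negPf (disc _ h2)) andbF.
    case/orP: sub => /andP[sa sb]; [left|right];
    exists a, b; split=> // x y h1 h2;
    by rewrite tail // h1 h2 ?orbT.
  move=> x y xd yf yc; rewrite su ?dis // add0r desc0 ?zig0 ?addr0 //.
  + by rewrite (negPf (dis' _ yf)) andbF.
  + by rewrite (negPf yc) andbF.
  by rewrite (negPf (dis' _ yf)) andbF.
- rewrite /= cat_uniq du un andbT /=; apply/hasPn => x; exact: dis'.
- move=> x y; rewrite sk (arrows_form_skew _ x).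
  by rewrite (arrows_form_skew (zigzag _ _) x); ring.
move=> x y; rewrite /= mem_cat negb_or => /andP[xd xf].
rewrite su // desc0 ?zig0 ?addr0 ?(negPf xd) //.
by apply/negP => /andP[/mem_flatten/(_ cC)]; rewrite (negPf xf).
Qed.
End Layouts.

(** * Growing a tree of chains *)

Section Growth.
Variable V : finType.
Implicit Types (B E : V -> V -> int) (c : seq V) (chs : seq (seq V)).
Implicit Types (n : V -> nat).
Implicit Types (p q u v x y z : V) (T U l r : tree V) (s : seq (V * tree V)).

(** A layout of [B] extends to one of [B + E] by new chains, with [n]
    indicating their vertices. *)
Definition grows B chs E n : Prop := exists chs',
  [/\ layout (fun x y => B x y + E x y) chs', {subset chs <= chs'}
    & forall x, ((x \in flatten chs') = (x \in flatten chs) + n x :> nat)%N].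

Lemma grows_trans B chs E n E' n' :
  grows B chs E n ->
  (forall chs', {subset chs <= chs'} ->
    (forall x, ((x \in flatten chs') = (x \in flatten chs) + n x :> nat)%N) ->
    layout (fun x y => B x y + E x y) chs' ->
    grows (fun x y => B x y + E x y) chs' E' n') ->
  grows B chs (fun x y => E x y + E' x y) (fun x => n x + n' x)%N.
Proof.
move=> [chs1 [lay1 sub1 cnt1]] /(_ _ sub1 cnt1 lay1) [chs2 [lay2 sub2 cnt2]].
exists chs2; split=> [|c /sub1/sub2 //|x]; last by rewrite cnt2 cnt1 addnA.
by apply: layout_ext lay2 _ => x y; ring.
Qed.

Lemma grows_ext B chs E n E' n' : grows B chs E n ->
  (forall x y, E' x y = E x y) -> n' =1 n -> grows B chs E' n'.
Proof.
move=> [chs' [lay sub cnt]] EE nn; exists chs'; split=> [|//|x].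
  by apply: layout_ext lay _ => x y; rewrite EE.
by rewrite nn cnt.
Qed.

Lemma grows0 B chs : layout B chs -> grows B chs (fun _ _ => 0) (fun _ => 0%N).
Proof.
move=> lay; exists chs; split=> [|//|x]; last by rewrite addn0.
by apply: layout_ext lay _ => x y; rewrite addr0.
Qed.

Lemma grows_cons B chs c d a b :
  layout B chs -> c \in chs -> d != [::] -> uniq d ->
  (forall x, (x \in flatten chs) + (x \in d) <= 1)%N ->
  (size b <= size a <= (size b).+1)%N ->
  (subseq a c && subseq b d) || (subseq a d && subseq b c) ->
  grows B chs (fun x y =>
    arrows_form (descents d) x y + arrows_form (zigzag a b) x y)
    (fun x => x \in d).
Proof.
move=> lay cC d0 du dis sz sub; exists (d :: chs); split.
- apply: (layout_cons lay cC) => // x xd.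
  by have := dis x; rewrite xd addn1; case: (x \in _).
- by move=> e eC; rewrite inE eC orbT.
move=> x; rewrite /= mem_cat; have := dis x.
by case: (x \in d); case: (x \in flatten chs).
Qed.

Definition root_seq T : seq V := if T is Node _ v _ then [:: v] else [::].

Definition below_count T x : nat :=
  if T is Node l _ r then (tree_count l x + tree_count r x)%N else 0%N.

Lemma tree_countE T x :
  tree_count T x = ((x \in root_seq T) + below_count T x)%N.
Proof. by case: T => //= l v r; rewrite inE addnA. Qed.

(** Once the root arc v of a polygon lies on a chain, the rest of the polygon is
    laid out downwards: the roots l and r of the two subtrees form a chain of
    their own, and r -> v -> l is the zigzag joining it to the chain of v. *)
Lemma grows_tree T B chs : layout B chs -> {subset root_seq T <= flatten chs} ->
  (forall x, (x \in flatten chs) + below_count T x <= 1)%N ->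
  grows B chs (tree_form T) (below_count T).
Proof.
elim: T B chs => [|l IHl v r IHr] B chs lay topT le1; first exact: grows0.
have /flattenP[c cC vc] : v \in flatten chs by apply: topT; rewrite inE.
have vf := mem_flatten vc cC.
have disj x :
  ((x \in flatten chs) + ((x \in root_seq r) + (x \in root_seq l)) <= 1)%N.
  have := le1 x; rewrite /= !tree_countE.
  by move: (x \in flatten chs) (x \in root_seq r) (x \in root_seq l) => *; lia.
have memd x : (x \in root_seq r ++ root_seq l)
    = ((x \in root_seq r) + (x \in root_seq l))%N :> nat.
  rewrite mem_cat; move: (disj x).
  by case: (x \in flatten chs); case: (x \in root_seq r);
    case: (x \in root_seq l).
have kids : grows B chs (tri (Some v) (root_arc l) (root_arc r))
    (fun x => x \in root_seq r ++ root_seq l).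
  have subv : subseq [:: v] c by rewrite sub1seq.
  have [d0|d0] := eqVneq (root_seq r ++ root_seq l) [::].
    case: l r d0 {IHl IHr topT le1 disj memd} => [|? ? ?] [|? ? ?] //= _.
    apply: grows_ext (grows0 lay) _ _ => // x y.
    by rewrite /tri /wedge /=; ring.
  have dis x :
    ((x \in flatten chs) + (x \in (root_seq r ++ root_seq l)) <= 1)%N.
    by rewrite memd.
  have ud : uniq (root_seq r ++ root_seq l).
    move: disj; clear; case: l r => [|? u ?] [|? w ?] //= /(_ u).
    rewrite !inE eqxx andbT (eq_sym w).
    by case: (u == w); case: (u \in flatten chs).
  (* The zigzag is r -> v -> l with the missing children left out, so it starts
     in the chain of v exactly when only l is present. *)
  pose a := if l is Leaf then root_seq r
            else if r is Leaf then [:: v] else root_seq r ++ root_seq l.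
  pose b := if l is Leaf then [:: v]
            else if r is Leaf then root_seq l else [:: v].
  have := @grows_cons B chs c (root_seq r ++ root_seq l) a b lay cC d0 ud dis.
  rewrite {}/a {}/b; move: d0; clear -lay subv.
  case: l r => [|l1 u l2] [|r1 w r2] //= _.
  - move=> h; apply: grows_ext (h _ _) _ _ => // [|x y].
      by rewrite /= eqxx subv ?orbT.
    rewrite /descents /zigzag /= arrows_form_cons /arrows_form.
    by rewrite /tri /wedge /=; ring.
  - move=> h; apply: grows_ext (h _ _) _ _ => // [|x y].
      by rewrite /= eqxx subv ?orbT.
    rewrite /descents /zigzag /= arrows_form_cons /arrows_form.
    by rewrite /tri /wedge /=; ring.
  - move=> h; apply: grows_ext (h _ _) _ _ => // [|x y].
      by rewrite /= !eqxx subv ?orbT.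
    rewrite /descents /zigzag /= !arrows_form_cons /arrows_form.
    by rewrite /tri /wedge /=; ring.
apply: grows_ext (grows_trans (E' := tree_form r) (n' := below_count r)
  (grows_trans (E' := tree_form l) (n' := below_count l) kids _) _) _ _.
- move=> chs' _ cnt lay'; apply: IHl => // x.
    move=> xl; move: (cnt x); rewrite memd xl; clear.
    by move: (x \in _) (x \in _) (x \in _) => [] //= f2 f3; lia.
  move: (cnt x) (le1 x); rewrite memd /= !tree_countE; clear.
  by move: (x \in _) (x \in _) (x \in _) (x \in _) => f1 f2 f3 f4; lia.
- move=> chs' _ cnt lay'; apply: IHr => // x.
    move=> xr; move: (cnt x); rewrite memd xr; clear.
    by move: (x \in _) (x \in _) (x \in _) => [] //= f2 f3; lia.
  move: (cnt x) (le1 x); rewrite memd /= !tree_countE; clear.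
  by move: (x \in _) (x \in _) (x \in _) (x \in _) => f1 f2 f3 f4; lia.
- by move=> x y.
move=> x /=; rewrite memd !tree_countE; clear.
by move: (x \in _) (x \in _) => f1 f2; lia.
Qed.

(** A side t of a triangle p -> t -> q, with p below q on an existing chain,
    becomes a one-vertex chain, joined to the old one by p -> t -> q. *)
Lemma grows_ear B chs c p q T :
  layout B chs -> c \in chs -> subseq [:: p; q] c ->
  (forall x, (x \in flatten chs) + tree_count T x <= 1)%N ->
  grows B chs (fun x y => wedge (Some p) (root_arc T) x y
    + wedge (root_arc T) (Some q) x y + tree_form T x y) (tree_count T).
Proof.
move=> lay cC pq le1; case: T le1 => [|l v r] le1.
  by apply: grows_ext (grows0 lay) _ _ => // x y; rewrite /wedge /=; ring.
set T := Node l v r.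
have kid : grows B chs (fun x y => wedge (Some p) (Some v) x y
    + wedge (Some v) (Some q) x y) (fun x => x \in [:: v]).
  apply: grows_ext
    (@grows_cons _ _ _ [:: v] [:: p; q] [:: v] lay cC _ _ _ _ _) _ _ => //.
  - move=> x; have := le1 x; rewrite (tree_countE T) /=.
    by move: (x \in _) (x \in _) => f1 f2; lia.
  - by rewrite pq /= eqxx.
  move=> x y; rewrite /zigzag /descents /= !arrows_form_cons /arrows_form /=.
  by ring.
apply: grows_ext
  (grows_trans (E' := tree_form T) (n' := below_count T) kid _) _ _ => //.
  move=> chs' _ cnt lay'; apply: grows_tree => // x.
    move=> xv; move: (cnt x); rewrite xv; clear.
    by move: (x \in _) (x \in _) => [] //= f2; lia.
  move: (cnt x) (le1 x); rewrite (tree_countE T) /=; clear.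
  by move: (x \in _) (x \in _) (x \in _) => f1 f2 f3; lia.
by move=> x; rewrite (tree_countE T).
Qed.

(** What a fan contributes besides the arrows p_(i+1) -> p_i of its chain of
    arcs to the puncture. *)
Fixpoint ears_form z s x y : int :=
  if s is (p, T) :: s' then
    wedge (Some p) (root_arc T) x y
    + wedge (root_arc T) (Some (head z (unzip1 s'))) x y + tree_form T x y
    + ears_form z s' x y
  else 0.

Fixpoint ears_count s x : nat :=
  if s is (_, T) :: s' then (tree_count T x + ears_count s' x)%N else 0%N.

Lemma fan_formE z s x y : fan_form z s x y =
  arrows_form (descents (rcons (unzip1 s) z)) x y + ears_form z s x y.
Proof.
elim: s => [|[p T] s IH] /=; first by rewrite /arrows_form /=; ring.
rewrite IH; case: s {IH} => [|[q U] s] /=.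
  by rewrite /descents /= arrows_form_cons /tri; ring.
rewrite {2}/descents /= arrows_form_cons /tri /descents /=; ring.
Qed.

Lemma grows_ears s B chs c z :
  layout B chs -> c \in chs -> subseq (rcons (unzip1 s) z) c ->
  (forall x, (x \in flatten chs) + ears_count s x <= 1)%N ->
  grows B chs (ears_form z s) (ears_count s).
Proof.
elim: s B chs => [|[p T] s IH] B chs lay cC sub le1; first exact: grows0.
apply: grows_trans.
  apply: (grows_ear lay cC) => [|x]; last by have := le1 x; rewrite /=; lia.
  apply: subseq_trans sub; rewrite /= eqxx.
  by case: (s) => [|[? ?] ?] /=; rewrite eqxx ?sub0seq.
move=> chs' sub' cnt lay'; apply: IH => // [||x].
- exact: sub'.
- by apply: subseq_trans sub; apply: subseq_cons.
by move: (cnt x) (le1 x) => /= ->; rewrite addnA.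
Qed.

Lemma fan_uniq s : (forall x, fan_count s x <= 1)%N -> uniq (unzip1 s).
Proof.
move=> le1; apply: count_mem_uniq => x.
have : (count_mem x (unzip1 s) <= fan_count s x)%N.
  elim: s {le1} => //= -[p T] s IH /=; rewrite eq_sym; lia.
move/leq_trans/(_ (le1 x)).
rewrite -has_pred1 has_count; by case: (count_mem x _) => [|[]].
Qed.

Lemma fan_countE s x : (forall x, fan_count s x <= 1)%N ->
  fan_count s x = ((x \in unzip1 s) + ears_count s x)%N.
Proof.
elim: s => [|[p T] s IH] //= le1; rewrite inE IH.
  2: by move=> y; have := le1 y; lia.
have := @fan_uniq ((p, T) :: s) le1; rewrite /= => /andP[ps _].
have [->|xp] := eqVneq x p; first by rewrite (negPf ps) /=; lia.
by rewrite /=; lia.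
Qed.
End Growth.

(** * Chains of a triangulation *)

Section Spanning.
Variable V : finType.
Implicit Types (B E : V -> V -> int) (c : seq V) (chs : seq (seq V)).
Implicit Types (n : V -> nat).
Implicit Types (p q u v w x y z : V) (T U l r : tree V) (s : seq (V * tree V)).

Definition laid_out B : Prop :=
  exists chs, layout B chs /\ forall x, x \in flatten chs.

Lemma grows_laid_out c E n B : c != [::] -> uniq c ->
  grows (arrows_form (descents c)) [:: c] E n ->
  (forall x y, B x y = arrows_form (descents c) x y + E x y) ->
  (forall x, (x \in c) + n x = 1)%N -> laid_out B.
Proof.
move=> c0 cu [chs [lay _ cnt]] BE one; exists chs; split.
  by apply: layout_ext lay _ => x y; rewrite BE.
move=> x; move: (cnt x); rewrite /= cats0 one.
by case: (x \in flatten chs).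
Qed.

Lemma card_le2 p q : (forall x, (x == p) || (x == q)) -> (#|V| <= 2)%N.
Proof.
move=> pq; rewrite cardE; apply: (@uniq_leq_size _ _ [:: p; q]).
  exact: enum_uniq.
by move=> x _; rewrite !inE.
Qed.

(** Around a digon the arrows are p -> t -> q -> u -> p, with t, u the roots of
    [T], [U] and u possibly missing: take p -> t -> q as a vertical chain and
    let u be an ear of it. *)
Lemma digon_laid_out p q T U :
  T <> Leaf -> spanning (Wheel [:: (p, T); (q, U)]) ->
  laid_out (form (Wheel [:: (p, T); (q, U)])).
Proof.
case: T => // l t r _; set T := Node l t r => -[_ /= cnt].
have cE x :
  ((x == p) + (x == q) + (x == t) + below_count T x + tree_count U x = 1)%N.
  by rewrite -[RHS](cnt x) /=; ring.
have cu : uniq [:: q; t; p].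
  move: (cE p) (cE q); rewrite /= !inE !eqxx (eq_sym q p).
  by case: (p == q); case: (q == t); rewrite ?(eq_sym t) //;
    case: (p == t) => //; lia.
have lay := layout1 (isT : [:: q; t; p] != [::]) cu.
have cC : [:: q; t; p] \in [:: [:: q; t; p]] by rewrite inE.
have mem3 x : ((x \in [:: q; t; p]) = (x == p) + (x == q) + (x == t) :> nat)%N.
  move: (cE x); rewrite !inE; clear.
  by case: (x == p); case: (x == q); case: (x == t) => /=; lia.
apply: (@grows_laid_out [:: q; t; p]) => //.
- apply: grows_trans (grows_ear (p := q) (q := p) (T := U) lay cC _ _) _.
  + by rewrite /= !eqxx; case: ifP; rewrite ?eqxx // sub0seq.
  + by move=> x; rewrite [flatten _]/= mem3; have := cE x; lia.
  move=> chs' _ cntc lay'; apply: (grows_tree (T := T)) => // x.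
    rewrite inE => /eqP->; move: (cntc t); rewrite /= !inE eqxx orbT /=; clear.
    by case: (t \in _) => //; lia.
  by rewrite cntc [flatten _]/= mem3; have := cE x; lia.
- move=> x y; rewrite /descents /= !arrows_form_cons /arrows_form.
  by rewrite /tri /wedge /=; ring.
by move=> x; rewrite mem3 -[RHS](cE x); ring.
Qed.

(** With at least three arcs to the puncture, let p be the first, e the last but
    one and w the last of them.  The arrows ... -> p_2 -> p make all of them
    except w a chain P, and p -> w -> e closes it up.  Each triangle on two
    neighbours within P is an ear.  The third sides t of the triangle on e, w
    and u of the triangle on w, p are both adjacent to w and to P, so they have
    to go into the chain of w, as t -> w -> u; then u -> p -> w -> e -> t is
    the zigzag between the two chains. *)
Lemma wheel_laid_out s :
  (2 < #|V|)%N -> spanning (Wheel s) -> laid_out (form (Wheel s)).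
Proof.
move=> V2 span; have [sz cnt] := span; rewrite /= in sz cnt.
have [s2|s3] := leqP (size s) 2.
  case: s s2 sz span cnt => [|[p T] [|[q U] [|]]] //= _ _ span cnt.
  have [T0|T0] : T = Leaf \/ T <> Leaf by case: (T); [left | right].
    have U0 : U <> Leaf.
      move=> U0; move: V2; rewrite ltnNge => /negP; apply.
      apply: (@card_le2 p q) => x.
      by have := cnt x; rewrite T0 U0 /=; case: (x == p); case: (x == q).
    have span' := spanning_rot (s1 := [:: _]) span.
    have [chs [lay full]] := digon_laid_out U0 span'.
    exists chs; split=> //; apply: layout_ext lay _ => x y.
    exact: (wheel_form_rot [:: (p, T)] [:: (q, U)]).
  exact: digon_laid_out.
case: (lastP s) s3 span cnt => [//|s1 [w U]]; case: (lastP s1) => [//|s0 [e T]].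
rewrite -!cats1 -catA {s s1 sz}; case: s0 => [//|[p W] s0] _ span cnt.
set s1 := (p, W) :: s0 in span cnt *.
have le1 : forall x, (fan_count (rcons s1 (e, T)) x <= 1)%N.
  by move=> x; have := cnt x; rewrite -cats1 !fan_count_cat /=; lia.
have := fan_uniq le1; rewrite /unzip1 map_rcons -/(unzip1 s1) [fst _]/= => uP.
set P := rcons (unzip1 s1) e in uP.
have cE x : ((x \in P) + ears_count s1 x
    + ((x == w) + tree_count T x + tree_count U x) = 1)%N.
  have le1' z : (fan_count s1 z <= 1)%N.
    by have := le1 z; rewrite -cats1 fan_count_cat; lia.
  have Pe : (x \in P) = ((x \in unzip1 s1) + (x == e))%N :> nat.
    move: uP; rewrite /P mem_rcons inE rcons_uniq => /andP[eN _].
    by have [->|_] := eqVneq x e; rewrite ?(negPf eN) //= addn0.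
  rewrite -[RHS](cnt x) fan_count_cat fan_countE // Pe /=; ring.
pose d := root_seq U ++ w :: root_seq T.
have dE x : ((x \in d)
    = (x == w) + (x \in root_seq T) + (x \in root_seq U) :> nat)%N.
  move: (cE x); move: (x \in P) => f1; rewrite !tree_countE /d mem_cat inE.
  clear; move: (x == w) (x \in root_seq T) (x \in root_seq U) => f2 f3 f4; lia.
have ud : uniq d.
  apply: count_mem_uniq => x; rewrite dE /d count_cat /=.
  have topE X : count_mem x (root_seq X) = (x \in root_seq X) :> nat.
    by case: X => //= _ v _; rewrite inE eq_sym addn0.
  by rewrite !topE eq_sym; ring.
have pe : subseq [:: p; e] P by rewrite /P /= eqxx sub1seq mem_rcons inE eqxx.
have lay := layout1 (isT : P != [::]) uP.
(* Without u the zigzag starts at p, in the chain P. *)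
pose a := if U is Leaf then [:: p; e] else d.
pose b := if U is Leaf then d else [:: p; e].
have fC : flatten [:: P] = P by rewrite /= cats0.
have PC : P \in [:: P] by rewrite inE.
apply: (@grows_laid_out P) => //.
- apply: (grows_trans (E' := tree_form U) (n' := below_count U)
    (grows_trans (E' := tree_form T) (n' := below_count T)
    (grows_trans (E' := fun x y =>
        arrows_form (descents d) x y + arrows_form (zigzag a b) x y)
       (n' := fun x => (x \in d : nat))
    (grows_ears (s := s1) (z := e) lay PC (subseq_refl _) _) _) _) _).
  + move=> x; rewrite fC; have := cE x; clear.
    by move: (x \in _) (x == _) => f1 f2; lia.
  + move=> chs' sub' cntc lay'; apply: (@grows_cons _ _ chs' P) => //.
    * exact: sub'.
    * by rewrite /d; case: (root_seq U).
    * move=> x; rewrite cntc dE fC; have := cE x; rewrite !tree_countE; clear.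
      by move: (x \in _) (x \in _) (x \in _) => f1 f2 f3; lia.
    * by rewrite /a /b /d; case: (U); case: (T).
    by rewrite /a /b; case: (U) => *; rewrite pe subseq_refl ?orbT.
  + move=> chs' _ cntc lay'; apply: grows_tree => // x.
      move=> xT; move: (cntc x); rewrite dE xT; clear.
      by move: (x \in _) (x \in _) (x \in _) => [] //= f1 f2; lia.
    rewrite cntc dE fC; have := cE x; rewrite !tree_countE; clear.
    by move: (x \in _) (x \in _) (x \in _) => f1 f2 f3; lia.
  move=> chs' _ cntc lay'; apply: grows_tree => // x.
    move=> xT; move: (cntc x); rewrite dE xT; clear.
    by move: (x \in _) (x \in _) (x \in _) => [] //= f1 f2; lia.
  rewrite cntc dE fC; have := cE x; rewrite !tree_countE; clear.
  by move: (x \in _) (x \in _) (x \in _) => f1 f2 f3; lia.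
- move=> x y.
  have -> : form (Wheel (s1 ++ [:: (e, T); (w, U)])) x y =
    fan_form e s1 x y
    + (tri (Some e) (root_arc T) (Some w) x y + tree_form T x y
      + (tri (Some w) (root_arc U) (Some p) x y + tree_form U x y)).
    rewrite -[LHS]/(fan_form p (s1 ++ [:: (e, T); (w, U)]) x y).
    by rewrite fan_form_cat /=; ring.
  rewrite fan_formE -/P /a /b /d /descents /zigzag.
  by case: (U) => [|? u ?]; case: (T) => [|? t ?] /=;
    rewrite !arrows_form_cons /arrows_form /tri /wedge /=; ring.
move=> x; rewrite -[RHS](cE x) dE !tree_countE; ring.
Qed.

(** Take t -> u, the roots of [T] and [U], as the first chain; p and q are two
    one-vertex chains with zigzags u -> p -> t and u -> q -> t. *)
Lemma fork_laid_out p q T U : (2 < #|V|)%N -> spanning (Fork p q T U) ->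
  laid_out (form (Fork p q T U)).
Proof.
move=> V2 [_ /= cnt].
have nonnil : root_seq U ++ root_seq T != [::].
  apply/eqP; move: cnt; case: T; case: U => // cnt _.
  move: V2; rewrite ltnNge => /negP; apply; apply: (@card_le2 p q) => x.
  by have := cnt x; rewrite /=; case: (x == p); case: (x == q).
pose d := root_seq U ++ root_seq T; have d0 : d != [::] by [].
have dE x : ((x \in d) = (x \in root_seq T) + (x \in root_seq U) :> nat)%N.
  move: (cnt x); rewrite !tree_countE /d mem_cat; clear.
  by move: (x == p) (x == q) (x \in root_seq T) (x \in root_seq U) => *; lia.
have ud : uniq d.
  apply: count_mem_uniq => x; rewrite dE /d count_cat /=.
  have topE X : count_mem x (root_seq X) = (x \in root_seq X) :> nat.
    by case: X => //= _ v _; rewrite inE eq_sym addn0.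
  by rewrite !topE; ring.
have lay := layout1 d0 ud.
have fC : flatten [:: d] = d by rewrite /= cats0.
have dC : d \in [:: d] by rewrite inE.
pose a z := if U is Leaf then [:: z] else d.
pose b z := if U is Leaf then d else [:: z].
have ab z : (size (b z) <= size (a z) <= (size (b z)).+1)%N.
  by move: d0; rewrite /a /b /d; case: (U); case: (T).
have sub z : (subseq (a z) d && subseq (b z) [:: z])
    || (subseq (a z) [:: z] && subseq (b z) d).
  by rewrite /a /b; case: (U) => *; rewrite !subseq_refl ?orbT.
apply: (@grows_laid_out d) => //.
- apply: (grows_trans (E' := tree_form U) (n' := below_count U)
    (grows_trans (E' := tree_form T) (n' := below_count T)
    (grows_trans (E' := fun x y => arrows_form (descents [:: q]) x y
        + arrows_form (zigzag (a q) (b q)) x y)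
      (n' := fun x => (x \in [:: q] : nat))
     (@grows_cons _ _ _ d [:: p] (a p) (b p) lay dC isT isT _ (ab p) (sub p))
     _) _) _).
  + move=> x; rewrite fC dE inE; have := cnt x; rewrite !tree_countE; clear.
    by move: (x \in _) (x \in _) => f1 f2; lia.
  + move=> chs' sub' cntc lay'; apply: (@grows_cons _ _ chs' d) => //.
      exact: sub'.
    move=> x; rewrite cntc fC dE !inE.
    have := cnt x; rewrite !tree_countE; clear.
    by move: (x \in _) (x \in _) => f1 f2; lia.
  + move=> chs' _ cntc lay'; apply: grows_tree => // x.
      move=> xT; move: (cntc x); rewrite fC dE xT; clear.
      by move: (x \in _) (x \in _) (x \in _) => [] //= f1 f2; lia.
    rewrite cntc fC dE !inE; have := cnt x; rewrite !tree_countE; clear.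
    by move: (x \in _) (x \in _) => f1 f2; lia.
  move=> chs' _ cntc lay'; apply: grows_tree => // x.
    move=> xT; move: (cntc x); rewrite fC dE xT; clear.
    by move: (x \in _) (x \in _) (x \in _) => [] //= f1 f2; lia.
  rewrite cntc fC dE !inE; have := cnt x; rewrite !tree_countE; clear.
  by move: (x \in _) (x \in _) => f1 f2; lia.
- move=> x y; rewrite /= /fork_form /a /b /d /descents /zigzag.
  move: d0; rewrite /d; case: (U) => [|? u ?]; case: (T) => [|? t ?] //= _;
  rewrite !arrows_form_cons /arrows_form /tri /wedge /=; ring.
move=> x; rewrite -[RHS](cnt x) dE !inE !tree_countE; ring.
Qed.

Lemma spanning_laid_out S : (2 < #|V|)%N -> spanning S -> laid_out (form S).
Proof.
by case: S => [p q T U|s]; [apply: fork_laid_out | apply: wheel_laid_out].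
Qed.
End Spanning.

(** * From trees of chains to the normal form *)

Section NormalForm.
Variable V : finType.
Implicit Types (B : V -> V -> int) (a b c d : seq V) (chs : seq (seq V)).
Implicit Types (x y u v : V).

Lemma zip_uniql a b : uniq a -> uniq (zip a b).
Proof.
elim: a b => [|u a IH] [|v b] //= /andP[ua un]; rewrite IH // andbT.
by apply/negP => /mem_zip[]; rewrite (negPf ua).
Qed.

(** The zigzag has no 2-cycles, so the multiplicities of its arrows can be read
    off its skew form. *)
Lemma zigzag_antisym a b x y : uniq a -> uniq b ->
  (x, y) \in zip a b -> (y, x) \notin zip b (behead a).
Proof.
elim: a b => [|u a IH] [|v b] //= /andP[ua uqa] /andP[vb uqb].
rewrite inE xpair_eqE => /orP[/andP[/eqP-> /eqP->]|xy].
  by apply/negP => /mem_zip[_]; rewrite (negPf ua).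
have [xa yb] := mem_zip xy; have := IH _ uqa uqb xy.
case: (a) => [//|w a'] /= yx; rewrite inE negb_or yx andbT xpair_eqE.
by apply/negP => /andP[/eqP yv]; rewrite -yv yb in vb.
Qed.

Lemma count_zip a b x y :
  uniq a -> count_mem (x, y) (zip a b) = ((x, y) \in zip a b).
Proof. by move=> ua; rewrite count_uniq_mem // zip_uniql. Qed.

Lemma descents_index c x y : uniq c -> x \in c -> y \in c ->
  ((x, y) \in descents c) = (index x c == (index y c).+1).
Proof.
rewrite /descents; case: c => //= p c; elim: c p => [|q c IH] p /=.
  by rewrite !inE => _ /eqP-> /eqP->; rewrite eqxx.
rewrite [x \in _]inE [y \in _]inE [(x, y) \in _]inE xpair_eqE.
case/andP=> pN uq; rewrite !(eq_sym p).
have [->|xp] := eqVneq x p.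
  move=> _ _; have -> : (p == q) = false.
    by apply: contraNF pN => /eqP->; rewrite inE eqxx.
  by apply/negP => /(@mem_zip _ c (q :: c))[pc _]; rewrite inE pc orbT in pN.
move=> /= xc; have [->|yp] := eqVneq y p => /= yc.
  rewrite andbT eqSS (eq_sym q); case: eqVneq => //= xq.
  by apply/negP => /(@mem_zip _ c (q :: c))[_ pc]; rewrite pc in pN.
by rewrite andbF /= IH.
Qed.

Lemma flatten_nth_inj chs i j x : uniq (flatten chs) ->
  x \in nth [::] chs i -> x \in nth [::] chs j -> i = j.
Proof.
have key s n : x \in nth [::] s n -> x \in flatten s.
  move=> xn; apply: (mem_flatten xn); apply: mem_nth; rewrite ltnNge.
  by apply/negP => sn; rewrite nth_default in xn.
elim: chs i j => [|d chs IH] [|i] [|j] //=.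
all: rewrite cat_uniq => /and3P[_ /hasPn dis un].
- by move=> xd /key/dis; rewrite /= xd.
- by move=> /key/dis xd; rewrite /= (negPf xd).
by move=> xi xj; rewrite (IH i j).
Qed.

Definition joined B c d := exists x y, [/\ x \in c, y \in d & B x y != 0].

Lemma chain_tree_nth B chs i : chain_tree B chs -> (i < size chs)%N ->
  nth [::] chs i != [::] /\ chain B (nth [::] chs i).
Proof.
by move=> tr; elim: tr i => [c c0 cB|c d {}chs _ IH cC d0 dB _ _] [|i] //=;
  apply: IH.
Qed.

Lemma chain_tree_joined B c d chs j : uniq (flatten chs) -> c \in chs ->
  (forall x y, x \in d -> y \in flatten chs -> y \notin c -> B x y = 0) ->
  (j < size chs)%N -> joined B d (nth [::] chs j) -> j = index c chs.
Proof.
move=> un cC far jn [x [y [xd yj]]] /eqP Bxy.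
apply: (flatten_nth_inj un yj); rewrite nth_index //.
apply/negPn/negP => yc; apply: Bxy; apply: far => //.
by apply: mem_flatten yj (mem_nth _ jn).
Qed.

Lemma chain_tree_oblique B chs i j : chain_tree B chs -> uniq (flatten chs) ->
  (i < j < size chs)%N -> joined B (nth [::] chs i) (nth [::] chs j) ->
  oblique B (nth [::] chs i) (nth [::] chs j)
  \/ oblique B (nth [::] chs j) (nth [::] chs i).
Proof.
move=> tr.
elim: tr i j => [c c0 cB i j _ /= ij|c d {}chs _ IH cC d0 dB obl far].
  by exfalso; lia.
move=> [|i] [|j] //=.
rewrite cat_uniq => /and3P[_ _ un] jn jo.
  have -> := chain_tree_joined un cC far jn jo.
  by rewrite nth_index //; case: obl; [right | left].
by rewrite cat_uniq => /and3P[_ _ un]; apply: IH.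
Qed.

(** This makes the graph of chains a forest. *)
Lemma chain_tree_unique B chs i j j' : chain_tree B chs -> uniq (flatten chs) ->
  (i < j < size chs)%N -> (i < j' < size chs)%N ->
  joined B (nth [::] chs i) (nth [::] chs j) ->
  joined B (nth [::] chs i) (nth [::] chs j') -> j = j'.
Proof.
move=> tr.
elim: tr i j j' => [c c0 cB i j j' _ /= ij|c d {}chs _ IH cC d0 dB _ far].
  by exfalso; lia.
move=> [|i] [|j] [|j'] //=.
  rewrite cat_uniq => /and3P[_ _ un] jn jn' /(chain_tree_joined un cC far jn)->.
  by move/(chain_tree_joined un cC far jn')->.
rewrite cat_uniq => /and3P[_ _ un] ij ij' jo jo'; congr S.
exact: (IH i).
Qed.

Section Realization.
Variables (Q : quiver V) (B : V -> V -> int) (chs : seq (seq V)) (x0 : V).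
Hypotheses (QB : realizes Q B) (chB : chain_tree B chs).
Hypotheses (un : uniq (flatten chs)).
Hypothesis full : forall x, x \in flatten chs.

Let chain_at (i : 'I_(size chs)) : seq V := nth [::] chs i.
Let len (i : 'I_(size chs)) : nat := size (chain_at i).
Let vertex : finType := {i : 'I_(size chs) & 'I_(len i)}.

Let vt i (l : 'I_(len i)) : vertex := @vtx _ len i l.

Definition vertex_at (w : vertex) : V := nth x0 (chain_at (tag w)) (tagged w).

Lemma vertex_at_mem w : vertex_at w \in chain_at (tag w).
Proof. by apply: mem_nth; apply: ltn_ord. Qed.

Lemma chain_at_uniq i : uniq (chain_at i).
Proof.
have := un; rewrite -[chs](cat_take_drop i) flatten_cat cat_uniq.
by rewrite (drop_nth [::] (ltn_ord i)) /= cat_uniq => /and3P[_ _ /andP[]].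
Qed.

Lemma vt_mem i l : vertex_at (@vt i l) \in chain_at i.
Proof. exact: vertex_at_mem (vt l). Qed.

Lemma index_vt i (l : 'I_(len i)) : index (vertex_at (vt l)) (chain_at i) = l.
Proof. by rewrite index_uniq ?chain_at_uniq. Qed.

Lemma chain_at_inj i j x : x \in chain_at i -> x \in chain_at j -> i = j.
Proof. by move=> xi xj; apply/val_inj/(flatten_nth_inj un xi xj). Qed.

Lemma vertex_at_inj : injective vertex_at.
Proof.
move=> [i l] [j m] E; have mj := @vt_mem _ m; rewrite /vt /vtx -E in mj.
have ij := chain_at_inj (@vt_mem _ l) mj.
case: j / ij m E {mj} => m E; congr (existT _ _ _); apply: val_inj.
by rewrite /= -index_vt -[RHS]index_vt /vt /vtx /Tagged E.
Qed.

Lemma vertex_at_surj x : exists w, vertex_at w == x.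
Proof.
have /flattenP[c cC xc] := full x.
have ic : (index c chs < size chs)%N by rewrite index_mem.
have chc : chain_at (Ordinal ic) = c by rewrite /chain_at /= nth_index.
have lx : (index x c < len (Ordinal ic))%N by rewrite /len chc index_mem.
by exists (@vt (Ordinal ic) (Ordinal lx)); rewrite /vertex_at /= chc nth_index.
Qed.

Definition position x : vertex := xchoose (vertex_at_surj x).

Lemma positionK : cancel position vertex_at.
Proof. by move=> x; apply/eqP; apply: (xchooseP (vertex_at_surj x)). Qed.

Lemma vertex_atK : cancel vertex_at position.
Proof. by move=> w; apply: vertex_at_inj; rewrite positionK. Qed.

Lemma chain_quiver_connected (w z : vertex) :
  connect (adj (fun w z => Q (vertex_at w) (vertex_at z))) w z.
Proof.
rewrite -[w]vertex_atK -[z]vertex_atK;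
have /connectP[p + ->] := quiver_connected Q (vertex_at w) (vertex_at z).
elim: p (vertex_at w) => [|y p IH] x /=; first by rewrite connect0.
case/andP=> xy /IH; apply: connect_trans; apply: connect1.
by rewrite /adj !positionK.
Qed.

Definition chain_quiver : quiver vertex :=
  @Quiver vertex (fun w z => Q (vertex_at w) (vertex_at z))
    (fun w => quiver_noloop Q (vertex_at w))
    (fun w z => @quiver_no2cycle _ Q (vertex_at w) (vertex_at z))
    chain_quiver_connected.

(** A form with values in -1, 0, 1 determines the arrows, as a quiver has no
    2-cycles. *)
Lemma arrowsE x y (s t : bool) : B x y = (s : nat)%:Z - (t : nat)%:Z ->
  ~~ (s && t) -> Q x y = s /\ Q y x = t.
Proof.
rewrite -QB; have := @quiver_no2cycle _ Q x y.
by case: (Q x y) => [_|n ->] //; case: s; case: t => //=; lia.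
Qed.

Lemma chain_quiver_vertical : vertical_chains chain_quiver.
Proof.
move=> i l m; rewrite /=.
have [_ chi] := chain_tree_nth chB (ltn_ord i).
have desc : uniq (descents (chain_at i)).
  rewrite /descents; case: (chain_at i) (chain_at_uniq i) => // p c /andP[_ uc].
  exact: zip_uniql.
have := chi _ _ (vt_mem l) (vt_mem m).
rewrite /arrows_form !count_uniq_mem //.
rewrite !descents_index ?vt_mem ?chain_at_uniq //.
rewrite !index_vt => /arrowsE[|-> //].
by apply/negP => /andP[/eqP-> /eqP]; lia.
Qed.

Lemma linked_joined i j :
  linked chain_quiver i j -> joined B (chain_at i) (chain_at j).
Proof.
case/existsP => l /existsP[m]; rewrite /adj /= => lm.
exists (vertex_at (vt l)), (vertex_at (vt m)); rewrite !vt_mem; split=> //.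
rewrite -QB.
move: lm (@quiver_no2cycle _ Q (vertex_at (vt l)) (vertex_at (vt m))).
rewrite /vt; case: (Q _ _) => [|n] /=; first by case: (Q _ _).
by move=> _ ->.
Qed.

(** A subsequence of a chain is the same as an increasing sequence of
    positions. *)
Lemma sub_ords i a : subseq a (chain_at i) -> exists2 a' : seq 'I_(len i),
  sorted ltn (map val a') & map (fun l => vertex_at (vt l)) a' = a.
Proof.
move=> sub; exists [seq l <- enum 'I_(len i) | vertex_at (vt l) \in a].
  apply: subseq_sorted (iota_ltn_sorted 0 (len i)); first exact: ltn_trans.
  by rewrite -val_enum_ord map_subseq // filter_subseq.
rewrite -(filter_map (fun l : 'I_(len i) => vertex_at (vt l)) (mem a)).
have -> : [seq vertex_at (vt l) | l <- enum 'I_(len i)] = chain_at i.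
  rewrite -[RHS](mkseq_nth x0) /mkseq -val_enum_ord -map_comp.
  by apply: eq_map.
by apply/esym/subseq_uniqP => //; apply: chain_at_uniq.
Qed.

Lemma chain_quiver_oblique_path i j :
  i != j -> oblique B (chain_at i) (chain_at j) ->
  oblique_path chain_quiver i j.
Proof.
move=> ij [a [b [ac bd sz Bab]]].
have ua := subseq_uniq ac (chain_at_uniq i).
have ub := subseq_uniq bd (chain_at_uniq j).
have dis x : x \in chain_at i -> x \in chain_at j -> False.
  by move=> xi xj; rewrite (chain_at_inj xi xj) eqxx in ij.
have Bzip x y : x \in chain_at i -> y \in chain_at j -> B x y =
    ((x, y) \in zip a b : nat)%:Z - ((y, x) \in zip b (behead a) : nat)%:Z.
  move=> xi yj; rewrite Bab // /arrows_form /zigzag !count_cat !count_zip //.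
  have -> : ((x, y) \in zip b (behead a)) = false.
    by apply/negP => /mem_zip[/(mem_subseq bd) xj]; case: (dis x).
  have -> : ((y, x) \in zip a b) = false.
    by apply/negP => /mem_zip[/(mem_subseq ac) yi]; case: (dis y).
  by rewrite addn0 add0n.
have [[a' sa Ea] [b' sb Eb]] := (sub_ords ac, sub_ords bd).
pose f (l : 'I_(len i)) := vertex_at (vt l).
pose g (m : 'I_(len j)) := vertex_at (vt m).
have fi : injective f.
  move=> l l' /(congr1 (index^~ (chain_at i))).
  by rewrite /f !index_vt => /val_inj.
have gi : injective g.
  move=> l l' /(congr1 (index^~ (chain_at j))).
  by rewrite /g !index_vt => /val_inj.
have zipm (X Y : eqType) (h : X -> V) (k : Y -> V) r s l m :
    injective h -> injective k ->
   ((h l, k m) \in zip (map h r) (map k s)) = ((l, m) \in zip r s).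
  move=> hi ki; elim: r s => [|l' r IH] [|m' s] //=.
  by rewrite !inE !xpair_eqE (inj_eq hi) (inj_eq ki) IH.
exists a', b'; split=> // [|l m|l m].
- by rewrite -(size_map f) Ea -(size_map g) Eb.
- have [|E _] := arrowsE (Bzip _ _ (vt_mem l) (vt_mem m)).
    by apply/negP => /andP[/(zigzag_antisym ua ub)/negPf->].
  by rewrite -(zipm _ _ f g) // Ea Eb; apply: E.
have [|_ E] := arrowsE (Bzip _ _ (vt_mem l) (vt_mem m)).
  by apply/negP => /andP[/(zigzag_antisym ua ub)/negPf->].
by rewrite -(zipm _ _ g f) // -behead_map Ea Eb; apply: E.
Qed.

Lemma linked_sym : symmetric (linked chain_quiver).
Proof.
move=> i j; apply/existsP/existsP => -[l /existsP[m lm]]; exists m;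
by apply/existsP; exists l; rewrite /adj orbC.
Qed.

Lemma chain_quiver_oblique : oblique_arrows chain_quiver.
Proof.
have key (i j : 'I_(size chs)) : (i < j)%N -> linked chain_quiver i j ->
    oblique_path chain_quiver i j \/ oblique_path chain_quiver j i.
  move=> ij /linked_joined /(chain_tree_oblique chB un) [|o|o].
  - by rewrite ij ltn_ord.
  - by left; apply: chain_quiver_oblique_path o; rewrite neq_ltn ij.
  by right; apply: chain_quiver_oblique_path o; rewrite neq_ltn ij orbT.
move=> i j; rewrite -val_eqE neq_ltn => /orP[|ji]; first exact: key.
by rewrite linked_sym => /(key _ _ ji)[]; [right | left].
Qed.

(** On a cycle of chains the one that comes first in the list would be joined
    to two distinct later ones. *)
Lemma chain_quiver_no_cycle : no_chain_cycle chain_quiver.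
Proof.
move=> i s /andP[sz _] us ps; apply/negP => li.
have cyc : cycle (linked chain_quiver) (i :: s).
  by rewrite /= rcons_path ps linked_sym.
case: (@arg_minnP _ i (mem (i :: s)) val); first exact: mem_head.
move=> m ms minm; case: (rot_to ms) => n t rt.
move: cyc us sz; rewrite -(rot_cycle n) -(rot_uniq n) -(size_rot n (i :: s)) rt.
case: (lastP t) rt => // t' y; case: t' => // x t' rt.
rewrite /= !rcons_path /= last_rcons => /and3P[mx _ ym] /andP[mN] /andP[xN _] _.
have in_s j : j \in [:: m, x & rcons t' y] -> j \in i :: s.
  by rewrite -rcons_cons -rt mem_rot.
have lt j : j \in x :: rcons t' y -> (m < j)%N.
  move=> jt; rewrite ltn_neqAle minm ?andbT.
  2: by apply: in_s; rewrite inE jt orbT.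
  by apply: contraNneq mN => /val_inj->.
have xy : x = y; last by rewrite xy mem_rcons mem_head in xN.
apply/val_inj/(chain_tree_unique chB un (i := m)).
- by rewrite lt ?mem_head ?ltn_ord.
- by rewrite lt ?ltn_ord // inE mem_rcons mem_head orbT.
- exact: linked_joined.
by apply: linked_joined; rewrite linked_sym.
Qed.

Lemma realization_QN : QN_quiver Q.
Proof.
exists (size chs), len, chain_quiver; split; last first.
  by exists vertex_at => //; exists position;
    [apply: vertex_atK | apply: positionK].
split.
- by case: chB.
- move=> i; have [+ _] := chain_tree_nth chB (ltn_ord i).
  by rewrite -size_eq0 -lt0n.
- exact: chain_quiver_vertical.
- exact: chain_quiver_oblique.
exact: chain_quiver_no_cycle.
Qed.
End Realization.
End NormalForm.

(** * The type D mutation class *)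

Lemma laid_out_QN (V : finType) (Q : quiver V) B :
  realizes Q B -> laid_out B -> QN_quiver Q.
Proof.
move=> QB [chs [[ch un _ _] full]].
have chs0 : (0 < size chs)%N by case: (ch).
have [+ _] := chain_tree_nth ch chs0; case: (nth _ _ _) => // x0 _ _.
exact: (realization_QN x0 QB ch un full).
Qed.

Lemma spanning_foldl (V : finType) (D : quiver V) (s : seq V) S :
  spanning S -> realizes D (form S) ->
  exists S', spanning S' /\
    realizes (foldl (fun R k => mutate k R) D s) (form S').
Proof.
elim: s D S => [|k s IH] D S span DS /=; first by exists S.
have [S' [span' mut]] := triangulation_mutates k span.
exact: IH span' (mutates_realizes DS mut).
Qed.

Lemma QN_quiver_iso (V W : finType) (Q : quiver V) (Q' : quiver W) :
  quiver_iso Q Q' -> QN_quiver Q -> QN_quiver Q'.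
Proof.
move=> [f bf fQ] [N [k [R [RN [g bg gR]]]]]; exists N, k, R; split=> //.
by exists (f \o g); [apply: bij_comp | move=> x y /=; rewrite fQ gR].
Qed.

Theorem proposition4p14 (V : finType) (Q : quiver V) : muD Q -> QN_quiver Q.
Proof.
case=> [[|[|[|m]]]] [D [// n4 orD [s iso]]].
apply: QN_quiver_iso iso _.
have [S [span DS]] := dynkin_spanning orD.
have [S' [span' realS']] := spanning_foldl s span DS.
by apply: laid_out_QN realS' (spanning_laid_out _ span'); rewrite card_ord.
Qed.
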